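(* Let $k\ge0$ be an integer and $0<\theta<1$. Then $B^{k+\theta}\hookrightarrow C_b^{k,\gamma}$ (continuous embedding) for all $0<\gamma<\theta$.
   Context: Functions are complex valued on $\mathbb R^n$; $\hat f(\xi)=\int_{\mathbb R^n}e^{-ix\cdot\xi}f(x)\,dx$ is the Fourier transform (extended to tempered distributions); $\langle\xi\rangle=\sqrt{1+|\xi|^2}$; $C_b^0$ is the space of bounded continuous functions on $\mathbb R^n$. For $s\ge0$, $B^s=\{f\in C_b^0:\ \langle\xi\rangle^s\hat f\in L^1(\mathbb R^n)\}$ with norm $\|f\|_{B^s}=\|\langle\xi\rangle^s\hat f\|_{L^1}$. $C_b^k$ is the space of $C^k$ functions on $\mathbb R^n$ whose partial derivatives up to order $k$ are bounded, with its usual sup norm. For $0<\beta\le1$, $[f]_\beta=\sup\{|f(x)-f(y)|/|x-y|^\beta:\ x,y\in\mathbb R^n,\ x\ne y\}$, and $C_b^{k,\beta}=\{f\in C_b^k:\ [\partial^\alpha f]_\beta<\infty,\ |\alpha|=k\}$ with norm $\|f\|_{C_b^{k,\beta}}=\|f\|_{C_b^k}+\sup_{|\alpha|=k}[\partial^\alpha f]_\beta$. *)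

(* Defs.v *)
From HB Require Import structures.
From mathcomp Require Import all_boot all_order all_algebra.
From mathcomp Require Import all_classical all_reals all_analysis.
From mathcomp Require Import complex.

Set Implicit Arguments.
Unset Strict Implicit.
Unset Printing Implicit Defensive.

Import Order.TTheory GRing.Theory Num.Def Num.Theory.
Import numFieldNormedType.Exports.

Local Open Scope classical_set_scope.
Local Open Scope ring_scope.
Local Open Scope complex_scope.

(* The product (equivalently, Borel) sigma-algebra on row vectors. *)
Section measurable_rV.
Context {R : realType} (n : nat).

Definition rV_coord (i : 'I_n) (v : 'rV[R]_n) : measurableTypeR R := v 0 i.

Let rV_set0 : g_sigma_preimage rV_coord set0.
Proof. exact: sigma_algebra0. Qed.

Let rV_setC A : g_sigma_preimage rV_coord A ->
  g_sigma_preimage rV_coord (~` A).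
Proof. exact: sigma_algebraC. Qed.

Let rV_bigcup (F : (set 'rV[R]_n)^nat) :
  (forall i, g_sigma_preimage rV_coord (F i)) ->
  g_sigma_preimage rV_coord (\bigcup_i F i).
Proof. exact: sigma_algebra_bigcup. Qed.

HB.instance Definition _ := @isMeasurable.Build
  (measure_tuple_display default_measure_display)
  'rV[R]_n (g_sigma_preimage rV_coord) rV_set0 rV_setC rV_bigcup.

End measurable_rV.

Section measurable_rV_theory.
Context {R : realType}.

Lemma measurable_rV_coord n (i : 'I_n) :
  measurable_fun [set: 'rV[R]_n] (@rV_coord R n i).
Proof.
move=> _ Y mY; rewrite setTI; apply: sub_sigma_algebra => /=.
by rewrite -bigcup_seq/=; exists i;
  [rewrite /= mem_index_enum|exists Y => //; rewrite setTI].
Qed.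

Lemma measurable_fun_rV d (T : measurableType d) n (f : T -> 'rV[R]_n) :
  (forall i, measurable_fun [set: T] (@rV_coord R n i \o f)) ->
  measurable_fun [set: T] f.
Proof.
move=> mf _ A mA; rewrite setTI.
pose S : set (set 'rV[R]_n) := [set B | measurable (f @^-1` B)].
suff : S A by [].
apply: (mA S); split; first split.
- by rewrite /S /= preimage_set0.
- by move=> B SB; rewrite /S /= setTD preimage_setC; exact: measurableC.
- by move=> F SF; rewrite /S /= preimage_bigcup; apply: bigcup_measurable => k _;
  exact: SF.
- rewrite -bigcup_seq => B [i _ [C mC <-]].
  by rewrite /S /= setTI -comp_preimage -[X in measurable X]setTI; exact: mf.
Qed.

Definition cons_rV n (p : measurableTypeR R * 'rV[R]_n) : 'rV[R]_n.+1 :=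
  \row_i if unlift ord0 i is Some j then p.2 0 j else p.1.

Definition uncons_rV n (v : 'rV[R]_n.+1) : measurableTypeR R * 'rV[R]_n :=
  (v 0 0, \row_j v 0 (lift ord0 j)).

Lemma cons_rVK n : cancel (@cons_rV n) (@uncons_rV n).
Proof.
move=> [x v]; congr pair; first by rewrite mxE unlift_none.
by apply/rowP => j; rewrite !mxE liftK.
Qed.

Lemma uncons_rVK n : cancel (@uncons_rV n) (@cons_rV n).
Proof.
move=> v; apply/rowP => i; rewrite !mxE.
by case: unliftP => [j ->|->] //=; rewrite mxE.
Qed.

Lemma measurable_cons_rV n : measurable_fun setT (@cons_rV n).
Proof.
apply: measurable_fun_rV => i; case: (unliftP ord0 i) => [j ->|->].
- rewrite (_ : _ \o _ = @rV_coord R n j \o snd).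
    by apply: measurableT_comp; [exact: measurable_rV_coord|].
  by apply/funext => p /=; rewrite /rV_coord mxE liftK.
- rewrite (_ : _ \o _ = fst)//.
  by apply/funext => p /=; rewrite /rV_coord mxE unlift_none.
Qed.

Lemma measurable_uncons_rV n : measurable_fun setT (@uncons_rV n).
Proof.
apply/measurable_fun_pairP; split; first exact: (measurable_rV_coord ord0).
apply: measurable_fun_rV => j.
rewrite (_ : _ \o _ = @rV_coord R n.+1 (lift ord0 j)).
  exact: measurable_rV_coord.
by apply/funext => v /=; rewrite /rV_coord mxE.
Qed.

End measurable_rV_theory.

(* Lebesgue measure on R^n, as an iterated product of the one-dimensional one;
   for n = 0 it is the unit mass on the only vector. *)
Section lebesgue_rVS.
Local Open Scope ereal_scope.
Context {R : realType} (n : nat).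
Variable mu : {sigma_finite_measure set 'rV[R]_n -> \bar R}.

Definition lebesgue_rVS : set 'rV[R]_n.+1 -> \bar R :=
  pushforward (@lebesgue_measure R \x mu) (@cons_rV R n).

Let lebesgue_rVS0 : lebesgue_rVS set0 = 0.
Proof. by rewrite /lebesgue_rVS /pushforward preimage_set0 measure0. Qed.

Let lebesgue_rVS_ge0 A : 0 <= lebesgue_rVS A.
Proof. by rewrite /lebesgue_rVS /pushforward measure_ge0. Qed.

Let lebesgue_rVS_sigma_additive : semi_sigma_additive lebesgue_rVS.
Proof.
have mc B : measurable B -> measurable (@cons_rV R n @^-1` B).
  by move=> mB; rewrite -[X in measurable X]setTI; exact: measurable_cons_rV.
move=> F mF tF mUF; rewrite /lebesgue_rVS /pushforward preimage_bigcup.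
apply: measure_semi_sigma_additive.
- by move=> i; exact: mc.
- apply/trivIsetP => /= i j _ _ ij; rewrite -preimage_setI.
  by move/trivIsetP : tF => /(_ _ _ _ _ ij) ->//; rewrite preimage_set0.
- by rewrite -preimage_bigcup; exact: mc.
Qed.

HB.instance Definition _ := isMeasure.Build _ _ _ lebesgue_rVS
  lebesgue_rVS0 lebesgue_rVS_ge0 lebesgue_rVS_sigma_additive.

Let lebesgue_rVS_sigma_finite : sigma_finite setT lebesgue_rVS.
Proof.
have /sigma_finiteP[F [TF ndF Foo]] :=
  sigma_finiteT (@lebesgue_measure R : {sigma_finite_measure set _ -> \bar R}).
have /sigma_finiteP[G [TG ndG Goo]] := sigma_finiteT mu.
exists (fun k => @uncons_rV R n @^-1` (F k `*` G k)).
  rewrite -preimage_bigcup (_ : \bigcup_k _ = setT) ?preimage_setT//.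
  apply/seteqP; split => // -[x v] _.
  have [i _ Fix] : (\bigcup_k F k) x by rewrite -TF.
  have [j _ Gjv] : (\bigcup_k G k) v by rewrite -TG.
  exists (maxn i j) => //; split => /=.
  - by move: x Fix; exact/subsetPset/ndF/leq_maxl.
  - by move: v Gjv; exact/subsetPset/ndG/leq_maxr.
move=> k; have [mF Fkoo] := Foo k; have [mG Gkoo] := Goo k; split.
  rewrite -[X in measurable X]setTI.
  by apply: measurable_uncons_rV => //; exact: measurableX.
rewrite /lebesgue_rVS /pushforward -comp_preimage.
rewrite (_ : _ \o _ = id) ?preimage_id; last exact/funext/cons_rVK.
by rewrite product_measure1E// lte_mul_pinfty// ge0_fin_numE.
Qed.

HB.instance Definition _ := Measure_isSigmaFinite.Build _ _ _ lebesgue_rVS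
  lebesgue_rVS_sigma_finite.

End lebesgue_rVS.

Fixpoint lebesgue_rV (R : realType) (n : nat) :
    {sigma_finite_measure set 'rV[R]_n -> \bar R} :=
  match n with
  | 0%N => dirac (0 : 'rV[R]_0)
  | n'.+1 => lebesgue_rVS (lebesgue_rV R n')
  end.

Section function_spaces.
Context {R : realType} {n : nat}.

(* Complex valued functions are handled through their real and imaginary parts
   for continuity, differentiation and integration. *)
Local Notation Rn := 'rV[R]_n.
Local Notation F := (Rn -> R[i]).
Local Notation mu := (lebesgue_rV R n).
Local Notation cRe := (@complex.Re R).
Local Notation cIm := (@complex.Im R).
Local Notation cabs := (@ComplexField.Normc.normc R).

Implicit Types (f g phi : F) (x y xi : Rn) (s b : R) (k m : nat).

Definition dotp x y : R := \sum_i x 0 i * y 0 i.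

(* The Euclidean norm; the library norm `|x| on matrices is the max norm. *)
Definition enorm x : R := Num.sqrt (dotp x x).

Definition japanese xi : R := Num.sqrt (1 + enorm xi ^+ 2).

Definition expi (t : R) : R[i] := cos t +i* sin t.

Definition cintegrable f : Prop :=
  mu.-integrable setT (EFin \o cRe \o f) /\
  mu.-integrable setT (EFin \o cIm \o f).

Definition cintegral f : R[i] :=
  (\int[mu]_x cRe (f x)) +i* (\int[mu]_x cIm (f x)).

Definition ccontinuous f : Prop :=
  continuous (cRe \o f) /\ continuous (cIm \o f).

Definition basis_vec (i : 'I_n) : Rn := delta_mx 0 i.

Definition has_partial (i : 'I_n) f : Prop :=
  forall x, derivable (cRe \o f) x (basis_vec i) /\
            derivable (cIm \o f) x (basis_vec i).

Definition partial (i : 'I_n) f : F := fun x =>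
  ('D_(basis_vec i) (cRe \o f) x) +i* ('D_(basis_vec i) (cIm \o f) x).

Fixpoint Ck k f : Prop :=
  ccontinuous f /\
  if k is k'.+1 then forall i, has_partial i f /\ Ck k' (partial i f) else True.

Definition multi_index := {ffun 'I_n -> nat}.

Definition mi_order (a : multi_index) : nat := (\sum_i a i)%N.

(* d_0^(a 0) (d_1^(a 1) (... f)); on functions of class C^|a| the order of the
   differentiations is irrelevant. *)
Definition mpartial (a : multi_index) f : F :=
  foldr (fun i => iter (a i) (partial i)) f (enum 'I_n).

Definition sup_norm f : \bar R := ereal_sup [set (cabs (f x))%:E | x in setT].

Definition Cb k : set F := [set f | Ck k f /\
  forall a, (mi_order a <= k)%N -> (sup_norm (mpartial a f) < +oo)%E].

Definition Cb_norm k f : \bar R :=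
  ereal_sup [set sup_norm (mpartial a f) | a in [set a | (mi_order a <= k)%N]].

Definition holder_seminorm b f : \bar R := ereal_sup
  [set (cabs (f p.1 - f p.2) / enorm (p.1 - p.2) `^ b)%:E
    | p in [set p : Rn * Rn | p.1 != p.2]].

Definition Cb_holder k b : set F := [set f | Cb k f /\
  forall a, mi_order a = k -> (holder_seminorm b (mpartial a f) < +oo)%E].

Definition Cb_holder_norm k b f : \bar R :=
  (Cb_norm k f + ereal_sup [set holder_seminorm b (mpartial a f)
                             | a in [set a | mi_order a = k]])%E.

Definition schwartz : set F := [set phi | (forall k, Ck k phi) /\
  forall a m,
    (sup_norm (fun x => (japanese x ^+ m)%:C * mpartial a phi x)%R < +oo)%E].

Definition fourier phi : F := fun xi =>
  cintegral (fun x => expi (- dotp x xi) * phi x).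

(* A tempered distribution is given by its values on Schwartz functions. *)
Definition distr_of f : F -> R[i] := fun phi => cintegral (fun x => f x * phi x).

Definition distr_fourier (T : F -> R[i]) : F -> R[i] := T \o fourier.

Definition is_fourierL1 f g : Prop := cintegrable g /\
  forall phi, schwartz phi -> distr_fourier (distr_of f) phi = distr_of g phi.

(* The L^1 function that represents the Fourier transform of f, when there is
   one; it is unique up to almost everywhere equality. *)
Definition fourierL1 f : F := xget (fun=> 0) [set g | is_fourierL1 f g].

Definition weighted_fourier s f : F := fun xi =>
  (japanese xi `^ s)%:C * fourierL1 f xi.

(* For s >= 0 the weight is at least 1, so that integrability of the weighted
   Fourier transform presupposes that the Fourier transform itself is in L^1. *)
Definition Bspace s : set F := [set f | Cb 0 f /\
  (exists g, is_fourierL1 f g) /\ cintegrable (weighted_fourier s f)].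

Definition B_norm s f : \bar R :=
  (\int[mu]_xi (cabs (weighted_fourier s f xi))%:E)%E.

(* The norms are only meaningful on the respective spaces. *)
Definition continuous_embedding (X : set F) (normX : F -> \bar R)
    (Y : set F) (normY : F -> \bar R) : Prop :=
  X `<=` Y /\
  exists C : R, 0 < C /\ forall f, X f -> (normY f <= C%:E * normX f)%E.

End function_spaces.

Arguments Bspace {R} n s.
Arguments B_norm {R} n s.
Arguments Cb_holder {R} n k b.
Arguments Cb_holder_norm {R} n k b.

(* Main.v *)
(* Write [g] for the Fourier transform of [f], a function in L^1.  Testing the
   identity that defines [g] on modulated Gaussians [e^(i x.xi) e^(-q|xi|^2)],
   whose Fourier transforms are Gaussians concentrating at [x] as [q] tends to
   0, gives the inversion formula
     [(2 pi)^n f(x) = \int e^(i x.xi) g(xi) dxi]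
   for every [x].  Differentiating under the integral multiplies [g] by
   [i xi_j], which costs one power of the weight, so that [f] has bounded
   derivatives up to order [k]; the Hoelder bound on those of order [k] follows
   from [|e^(is) - e^(it)| <= 2 |s - t|^gamma], which costs the further power
   [gamma < theta] of the weight. *)
Require Import Defs.
From mathcomp Require Import all_boot all_order all_algebra.
From mathcomp Require Import all_classical all_reals all_analysis.
From mathcomp Require Import measurable_realfun complex ring lra.
Import Order.TTheory GRing.Theory Num.Theory.
Import numFieldNormedType.Exports.

Set Implicit Arguments.
Unset Strict Implicit.
Unset Printing Implicit Defensive.

Local Open Scope classical_set_scope.
Local Open Scope ring_scope.
Local Open Scope complex_scope.

(** The assumption on [g] is only an identity between integrals against Schwartz functions, so the
    test functions must be proved Schwartz and their transforms computed before anything is known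
    about [f] at a point. Modulated Gaussians serve both ends: their derivatives are polynomial
    multiples of themselves, and their transforms follow from an ordinary differential equation in
    the frequency, with no contour integration. Since [f] is bounded and continuous, its Gaussian
    means converge at every point and not just almost everywhere, so the formula represents [f]
    itself. A derivative of order m is again an integral of e^(i x.xi) h(xi) with |h| <= <xi>^m
    A(xi); one class of such integrals carries the sup bounds, the continuity and the Hoelder
    estimates. Constants are not optimised: estimating a complex integral through its two parts
    costs a factor 2, and estimating x.xi coordinate by coordinate costs a factor n. *)

Local Notation cabs := (@ComplexField.Normc.normc _).

(** * Complex modulus and exponential *)

Section complex_modulus.
Variable R : realType.
Implicit Types (z w : R[i]) (t : R).

Lemma normcE z : cabs z = Num.sqrt (complex.Re z ^+ 2 + complex.Im z ^+ 2).
Proof. by case: z. Qed.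

Lemma normc_ge0 z : 0 <= cabs z.
Proof. by rewrite normcE sqrtr_ge0. Qed.

Lemma normr_Re_le z : `|complex.Re z| <= cabs z.
Proof. by rewrite normcE -sqrtr_sqr ler_wsqrtr// lerDl sqr_ge0. Qed.

Lemma normr_Im_le z : `|complex.Im z| <= cabs z.
Proof. by rewrite normcE -sqrtr_sqr ler_wsqrtr// lerDr sqr_ge0. Qed.

Lemma normc_leReIm z : cabs z <= `|complex.Re z| + `|complex.Im z|.
Proof.
rewrite normcE -[leRHS]ger0_norm ?addr_ge0// -sqrtr_sqr ler_wsqrtr//.
rewrite sqrrD !real_normK ?num_real//.
by rewrite -addrA [X in _ <= _ + X]addrC addrA lerDl mulrn_wge0// mulr_ge0.
Qed.

Lemma cReM z w : complex.Re (z * w) =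
  complex.Re z * complex.Re w - complex.Im z * complex.Im w.
Proof. by case: z; case: w. Qed.

Lemma cImM z w : complex.Im (z * w) =
  complex.Re z * complex.Im w + complex.Im z * complex.Re w.
Proof. by case: z; case: w. Qed.

Lemma cReD z w : complex.Re (z + w) = complex.Re z + complex.Re w.
Proof. by case: z; case: w. Qed.

Lemma cImD z w : complex.Im (z + w) = complex.Im z + complex.Im w.
Proof. by case: z; case: w. Qed.

Lemma cReB z w : complex.Re (z - w) = complex.Re z - complex.Re w.
Proof. by case: z; case: w. Qed.

Lemma cImB z w : complex.Im (z - w) = complex.Im z - complex.Im w.
Proof. by case: z; case: w. Qed.

Lemma complexP z w : complex.Re z = complex.Re w ->
  complex.Im z = complex.Im w -> z = w.
Proof. by case: z; case: w => a b c d /= -> ->. Qed.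

Lemma normcC t : cabs t%:C = `|t|.
Proof. by rewrite normcE/= expr0n addr0 sqrtr_sqr. Qed.

Lemma normcM z w : cabs (z * w) = cabs z * cabs w.
Proof. exact: ComplexField.Normc.normcM. Qed.

Lemma normcB_le z w : cabs (z - w) <= cabs z + cabs w.
Proof. by rewrite -[cabs w]normcN; exact: (@le_normcD _ z (- w)). Qed.

Lemma normc_expi t : cabs (expi t) = 1.
Proof. by rewrite normcE/= cos2Dsin2 sqrtr1. Qed.

Lemma expiD (s t : R) : expi (s + t) = expi s * expi t.
Proof. by apply: complexP; rewrite /= ?cReM ?cImM/= ?cosD ?sinD// addrC. Qed.

Lemma ler_norm_cosB (s t : R) : `|cos s - cos t| <= `|s - t|.
Proof.
wlog st : s t / s <= t.
  move=> H; have [|/ltW] := leP s t; first exact: H.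
  by rewrite distrC (distrC s); exact: H.
rewrite distrC (distrC s).
have [c _ ->] := @MVT_segment R cos (fun x => - sin x) s t st
  (fun x _ => is_derive_cos x)
  (continuous_subspaceT (@continuous_cos R)).
rewrite normrM normrN ler_piMl// ler_norml; apply/andP; split.
  exact: sin_geN1.
exact: sin_le1.
Qed.

Lemma ler_norm_sinB (s t : R) : `|sin s - sin t| <= `|s - t|.
Proof.
rewrite -!cosBpihalf; have -> : s - t = (s - pi / 2) - (t - pi / 2) by ring.
exact: ler_norm_cosB.
Qed.

(* The increment is at most [min(2, 2|s - t|)], and [min(1, u) <= u ^ b]. *)
Lemma normc_expiB_le (b s t : R) : 0 < b <= 1 ->
  cabs (expi s - expi t) <= 2 * `|s - t| `^ b.
Proof.
move=> /andP[b0 b1]; have [st|st] := leP `|s - t| 1.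
- apply: (@le_trans _ _ (2 * `|s - t|)).
    apply: (le_trans (normc_leReIm _)).
    by rewrite cReB cImB/= mulr_natl mulr2n lerD ?ler_norm_cosB ?ler_norm_sinB.
  rewrite ler_pM2l//.
  have [->|st0] := eqVneq `|s - t| 0; first exact: powR_ge0.
  by rewrite ger1_powR// lt0r st0 normr_ge0.
- apply: (le_trans (normcB_le _ _)); rewrite !normc_expi.
  rewrite -[leLHS]mulr1 ler_pM2l// -(powRr0 `|s - t|).
  by rewrite ler_powR// ltW.
Qed.

End complex_modulus.

(** * Integration of complex valued functions *)

Section real_integration.
Context d (T : measurableType d) (R : realType).
Variable mu : {measure set T -> \bar R}.
Implicit Types f g : T -> R.

Lemma integrable_le f g : measurable_fun setT f ->
  mu.-integrable setT (EFin \o g) -> (forall x, `|f x| <= g x) ->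
  mu.-integrable setT (EFin \o f).
Proof.
move=> mf ig fg; apply: le_integrable ig => //; first exact/measurable_EFinP.
by move=> x _; rewrite /= lee_fin (le_trans (fg x))// ler_norm.
Qed.

Lemma integrable_measurable f :
  mu.-integrable setT (EFin \o f) -> measurable_fun setT f.
Proof. by move/measurable_int/measurable_EFinP. Qed.

Lemma integrableDr f g : mu.-integrable setT (EFin \o f) ->
  mu.-integrable setT (EFin \o g) ->
  mu.-integrable setT (EFin \o (fun x => f x + g x)).
Proof. by move=> fi gi; exact: (integrableD _ fi gi). Qed.

Lemma integrableBr f g : mu.-integrable setT (EFin \o f) ->
  mu.-integrable setT (EFin \o g) ->
  mu.-integrable setT (EFin \o (fun x => f x - g x)).
Proof. by move=> fi gi; exact: (integrableB _ fi gi). Qed.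

Lemma integrableZr (r : R) f : mu.-integrable setT (EFin \o f) ->
  mu.-integrable setT (EFin \o (fun x => r * f x)).
Proof. by move=> fi; exact: (integrableZl _ r fi). Qed.

Lemma integrable_normr f : mu.-integrable setT (EFin \o f) ->
  mu.-integrable setT (EFin \o (fun x => `|f x|)).
Proof. by move=> fi; exact: (integrable_norm fi). Qed.

Lemma dominated_cvg_Rintegral (f_ : nat -> T -> R) f g :
  (forall m, measurable_fun setT (f_ m)) ->
  (forall x, f_ m x @[m --> \oo] --> f x) ->
  mu.-integrable setT (EFin \o g) -> (forall m x, `|f_ m x| <= g x) ->
  \int[mu]_x f_ m x @[m --> \oo] --> \int[mu]_x f x.
Proof.
move=> mf ff ig fg; have mflim : measurable_fun setT f.
  exact: measurable_fun_cvg mf (fun x _ => ff x).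
have [|||||fi _ fcvg] := @dominated_convergence _ _ _ mu _ measurableT
  (fun m => EFin \o f_ m) (EFin \o f) (EFin \o g).
- by move=> m; exact/measurable_EFinP.
- exact/measurable_EFinP.
- by apply: aeW => x _; apply: cvg_EFin; [exact: nearW|exact: ff].
- exact: ig.
- by apply: aeW => x m _; rewrite /= lee_fin.
by apply: fine_cvg; rewrite fineK//; exact: integrable_fin_num.
Qed.

End real_integration.

Section complex_integration.
Variables (R : realType) (n : nat).
Local Notation Rn := 'rV[R]_n.
Local Notation mu := (lebesgue_rV R n).
Implicit Types (f g : Rn -> R[i]) (H : Rn -> R).

Definition cmeasurable f := measurable_fun setT (@complex.Re R \o f) /\
  measurable_fun setT (@complex.Im R \o f).

Lemma cintegrable_cmeasurable f : cintegrable f -> cmeasurable f.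
Proof. by move=> [/integrable_measurable ? /integrable_measurable ?]. Qed.

Lemma cmeasurable_normc f : cmeasurable f ->
  measurable_fun setT (fun x => cabs (f x)).
Proof.
move=> [mr mi]; under eq_fun do rewrite normcE.
apply: (measurableT_comp (f := @Num.sqrt R)).
  apply: continuous_measurable_fun; exact: (sqrt_continuous).
by apply: measurable_funD; apply: measurable_funX.
Qed.

Lemma cmeasurableM f g : cmeasurable f -> cmeasurable g ->
  cmeasurable (fun x => f x * g x).
Proof.
move=> [fr fi] [gr gi]; split.
- rewrite (_ : _ \o _ = fun x => complex.Re (f x) * complex.Re (g x) -
    complex.Im (f x) * complex.Im (g x)); last by apply/funext => x; exact: cReM.
  by apply: measurable_funB; apply: measurable_funM.
- rewrite (_ : _ \o _ = fun x => complex.Re (f x) * complex.Im (g x) +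
    complex.Im (f x) * complex.Re (g x)); last by apply/funext => x; exact: cImM.
  by apply: measurable_funD; apply: measurable_funM.
Qed.

Lemma cmeasurableC H : measurable_fun setT H -> cmeasurable (fun x => (H x)%:C).
Proof. by move=> mH; split => //; exact: measurable_cst. Qed.

Lemma cmeasurable_expi H : measurable_fun setT H ->
  cmeasurable (fun x => expi (H x)).
Proof.
move=> mH; split.
- apply: (measurableT_comp (f := @cos R)) => //.
  apply: continuous_measurable_fun; exact: (@continuous_cos R).
- apply: (measurableT_comp (f := @sin R)) => //.
  apply: continuous_measurable_fun; exact: (@continuous_sin R).
Qed.

Lemma cintegrable_le f H : cmeasurable f -> mu.-integrable setT (EFin \o H) ->
  (forall x, cabs (f x) <= H x) -> cintegrable f.
Proof.
move=> [fr fi] iH fH; split; apply: (integrable_le _ iH) => // x.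
- exact: le_trans (normr_Re_le _) (fH x).
- exact: le_trans (normr_Im_le _) (fH x).
Qed.

Lemma cintegrable_normc f : cintegrable f ->
  mu.-integrable setT (EFin \o (fun x => cabs (f x))).
Proof.
move=> fi; have mf := cintegrable_cmeasurable fi; case: fi => fr fi.
apply: (integrable_le _ (integrableDr (integrable_normr fr)
  (integrable_normr fi))); first exact: cmeasurable_normc.
by move=> x; rewrite ger0_norm ?normc_ge0//; exact: normc_leReIm.
Qed.

(** The factor 2 comes from bounding the real and imaginary parts separately, each by the integral
    of [H]; this avoids rotating the integral onto the real axis. *)
Lemma normc_cintegral_le f H : cmeasurable f ->
  mu.-integrable setT (EFin \o H) -> (forall x, cabs (f x) <= H x) ->
  cabs (cintegral f) <= 2 * \int[mu]_x H x.
Proof.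
move=> mf iH fH; have [fr fi] := cintegrable_le mf iH fH.
apply: (le_trans (normc_leReIm _)); rewrite mulr_natl mulr2n lerD//=.
- apply: (le_trans (le_normr_Rintegral measurableT fr)).
  apply: le_Rintegral => //; first exact: integrable_normr.
  by move=> x _; exact: le_trans (normr_Re_le _) (fH x).
- apply: (le_trans (le_normr_Rintegral measurableT fi)).
  apply: le_Rintegral => //; first exact: integrable_normr.
  by move=> x _; exact: le_trans (normr_Im_le _) (fH x).
Qed.

Lemma cintegralB f g : cintegrable f -> cintegrable g ->
  cintegral (fun x => f x - g x) = cintegral f - cintegral g.
Proof.
move=> [fr fi] [gr gi]; apply: complexP; rewrite ?cReB ?cImB/=.
- rewrite -RintegralB//; apply: eq_Rintegral => x _; exact: cReB.
- rewrite -RintegralB//; apply: eq_Rintegral => x _; exact: cImB.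
Qed.

Lemma cintegralZ (c : R[i]) f : cintegrable f ->
  cintegral (fun x => c * f x) = c * cintegral f.
Proof.
move=> [fr fi]; apply: complexP; rewrite ?cReM ?cImM/=.
- rewrite -!RintegralZl// -RintegralB//; try exact: integrableZr.
  by apply: eq_Rintegral => x _; rewrite -cReM.
- rewrite -!RintegralZl// -RintegralD//; try exact: integrableZr.
  by apply: eq_Rintegral => x _; rewrite -cImM.
Qed.

End complex_integration.

(** * Euclidean structure and measurability on row vectors *)

Section euclidean.
Variables (R : realType) (n : nat).
Local Notation Rn := 'rV[R]_n.
Implicit Types x y z xi : Rn.

Lemma dotpC x y : dotp x y = dotp y x.
Proof. by apply: eq_bigr => i _; rewrite mulrC. Qed.

Lemma dotpDl x y z : dotp (x + y) z = dotp x z + dotp y z.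
Proof. by rewrite -big_split; apply: eq_bigr => i _; rewrite !mxE mulrDl. Qed.

Lemma dotpZl (t : R) x y : dotp (t *: x) y = t * dotp x y.
Proof. by rewrite /dotp mulr_sumr; apply: eq_bigr => i _; rewrite !mxE mulrA. Qed.

Lemma dotpNl x y : dotp (- x) y = - dotp x y.
Proof. by rewrite -scaleN1r dotpZl mulN1r. Qed.

Lemma dotpNr x y : dotp x (- y) = - dotp x y.
Proof. by rewrite dotpC dotpNl dotpC. Qed.

Lemma dotpBl x y z : dotp (x - y) z = dotp x z - dotp y z.
Proof. by rewrite dotpDl dotpNl. Qed.

Lemma dotp_basis_vec i x : dotp (basis_vec i) x = x 0 i.
Proof.
rewrite /dotp (bigD1 i)//= mxE !eqxx/= mul1r big1 ?addr0// => j ji.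
by rewrite mxE eqxx (negbTE ji) mul0r.
Qed.

Lemma dotp_ge0 x : 0 <= dotp x x.
Proof. by apply: sumr_ge0 => i _; rewrite -expr2 sqr_ge0. Qed.

Lemma enorm_ge0 x : 0 <= enorm x.
Proof. exact: sqrtr_ge0. Qed.

Lemma sqr_enorm x : enorm x ^+ 2 = dotp x x.
Proof. by rewrite sqr_sqrtr ?dotp_ge0. Qed.

Lemma coord_le_enorm i x : `|x 0 i| <= enorm x.
Proof.
rewrite /enorm -sqrtr_sqr ler_wsqrtr// /dotp (bigD1 i)//= -expr2 lerDl.
by apply: sumr_ge0 => j _; rewrite -expr2 sqr_ge0.
Qed.

(** A crude form of Cauchy-Schwarz: each of the [n] products is at most the product of the norms.
    The factor only enters the constant of the embedding. *)
Lemma normr_dotp_le x y : `|dotp x y| <= n%:R * (enorm x * enorm y).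
Proof.
apply: (le_trans (ler_norm_sum _ _ _)).
rewrite mulr_natl -[X in _ *+ X]card_ord -sumr_const ler_sum// => i _.
by rewrite normrM ler_pM ?coord_le_enorm.
Qed.

Lemma enorm_eq0 x : (enorm x == 0) = (x == 0).
Proof.
apply/eqP/eqP => [x0|->]; last first.
  by rewrite /enorm /dotp big1 ?sqrtr0// => i _; rewrite mxE mul0r.
apply/rowP => i; apply/eqP; rewrite mxE -normr_le0.
by have := coord_le_enorm i x; rewrite x0.
Qed.

Lemma coord_le_normr i x : `|x 0 i| <= `|x|.
Proof.
rewrite [`|x|]mx_normrE.
by apply: (@le_bigmax _ _ _ 0 (fun ij => `|x ij.1 ij.2|) (0, i)).
Qed.

(** The squares are compared: a sum of [n] squares is at most n |x|^2, and n <= n^2. *)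
Lemma enorm_le_normr x : enorm x <= n%:R * `|x|.
Proof.
rewrite -[leRHS]ger0_norm ?mulr_ge0// -sqrtr_sqr ler_wsqrtr// /dotp exprMn.
apply: (@le_trans _ _ (\sum_(i < n) `|x| ^+ 2)).
  apply: ler_sum => i _; rewrite -expr2 -real_normK ?num_real//.
  by rewrite lerXn2r ?nnegrE// coord_le_normr.
rewrite sumr_const card_ord -[leLHS]mulr_natl ler_wpM2r ?sqr_ge0//.
by rewrite -natrX ler_nat; case: n => // m; rewrite -{1}[m.+1]expn1 leq_pexp2l.
Qed.

Lemma japanese_ge1 x : 1 <= japanese x.
Proof. by rewrite -{1}[1]sqrtr1 ler_wsqrtr// lerDl sqr_ge0. Qed.

Lemma enorm_le_japanese x : enorm x <= japanese x.
Proof.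
by rewrite /japanese -[leLHS]ger0_norm ?enorm_ge0// -sqrtr_sqr ler_wsqrtr// lerDr.
Qed.

Lemma coord_le_japanese i x : `|x 0 i| <= japanese x.
Proof. exact: le_trans (coord_le_enorm i x) (enorm_le_japanese x). Qed.

Lemma japanese_gt0 x : 0 < japanese x.
Proof. exact: lt_le_trans (japanese_ge1 x). Qed.

Lemma measurable_coord i : measurable_fun setT (fun x => x 0 i).
Proof. exact: measurable_rV_coord. Qed.

Lemma measurable_dotp x : measurable_fun setT (dotp x).
Proof.
apply: measurable_sum => i; apply: measurable_funM; first exact: measurable_cst.
exact: measurable_coord.
Qed.

Lemma measurable_dotpxx : measurable_fun setT (fun x => dotp x x).
Proof.
by apply: measurable_sum => i; apply: measurable_funM; exact: measurable_coord.
Qed.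

Lemma measurable_japanese : measurable_fun setT (@japanese R n).
Proof.
apply: (measurableT_comp (f := @Num.sqrt R)).
  by apply: continuous_measurable_fun; exact: sqrt_continuous.
apply: measurable_funD; first exact: measurable_cst.
by under eq_fun do rewrite sqr_enorm; exact: measurable_dotpxx.
Qed.

End euclidean.

(** * Continuous functions on R^n are measurable for the product sigma-algebra *)

Section continuous_measurable.
Variables (R : realType) (n : nat).
Local Notation Rn := 'rV[R]_n.

(** Positivity of [e] has to be stated, since in dimension 0 the coordinates impose no condition. *)
Lemma ball_rVE (x y : Rn) (e : R) :
  ball x e y <-> 0 < e /\ forall i, `|x 0 i - y 0 i| < e.
Proof.
split=> [[e0 xy]|[e0 xy]]; split => //; first by move=> i; exact: (xy 0 i).
by move=> i j; rewrite ord1; exact: xy.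
Qed.

Lemma measurable_ball_rV (x : Rn) (e : R) : measurable (ball x e).
Proof.
have [e0|e0] := leP e 0.
  rewrite (_ : ball x e = set0) //; apply/seteqP; split => // y /ball_rVE[].
  by rewrite ltNge e0.
rewrite (_ : ball x e = \bigcap_(i in [set: 'I_n])
  ((fun y : Rn => y 0 i) @^-1` ball (x 0 i) e)).
  apply: fin_bigcap_measurable => // i _; rewrite -[X in measurable X]setTI.
  by apply: (measurable_coord i) => //; exact: measurable_ball.
apply/seteqP; split => [y /ball_rVE[_ xy] i _|y xy]; first exact: xy.
by apply/ball_rVE; split => // i; exact: xy.
Qed.

(** An open set is the countable union of the balls with rational centre and radius that it
    contains; the other indices contribute the empty set. *)
Lemma open_measurable_rV (U : set Rn) : open U -> measurable U.
Proof.
move=> oU; pose B (q : 'rV[rat]_n * rat) : set Rn :=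
  ball (map_mx ratr q.1 : Rn) (ratr q.2).
have -> : U = \bigcup_q (if `[< B q `<=` U >] then B q else set0).
  apply/seteqP; split => [x Ux|x [q _]]; last by case: asboolP => // qU /qU.
  move: oU; rewrite openE => /(_ x Ux) /nbhs_ballP[e /= e0 eU].
  (* The radius is below e / 2 and the centre is within the radius of [x], so every point of the
     rational ball is within [e] of [x]. *)
  have [r] := @rat_in_itvoo R 0 (e / 2) (divr_gt0 e0 (ltr0Sn _ _)).
  rewrite in_itv/= => /andP[r0 re].
  have /choice[q qx] i : exists q : rat, `|ratr q - x 0 i| < ratr r :> R.
    have [|q] := @rat_in_itvoo R (x 0 i - ratr r) (x 0 i + ratr r).
      by rewrite ltrBlDr -addrA ltrDl addr_gt0.
    by rewrite in_itv/= -ltr_distl => ?; exists q.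
  exists (\row_i q i, r) => //; case: asboolP => [_|].
    by apply/ball_rVE; split => //= i; rewrite !mxE.
  case=> y /ball_rVE[_ By]; apply: eU; apply/ball_rVE; split => // i.
  have := By i; rewrite !mxE => qy; rewrite distrC.
  have -> : y 0 i - x 0 i = - (ratr (q i) - y 0 i) + (ratr (q i) - x 0 i) by ring.
  apply: (le_lt_trans (ler_normD _ _)); rewrite normrN (splitr e).
  by rewrite ltrD// (lt_trans _ re).
apply: countable_bigcupT_measurable => [|q]; first exact: countableP.
by case: ifP => _ //; exact: measurable_ball_rV.
Qed.

Lemma continuous_measurable_rV (f : Rn -> R) :
  continuous f -> measurable_fun setT f.
Proof.
move=> cf; apply: (measurability _ (RGenOpens.measurableE R)).
move=> _ [_ [a [b ->]] <-]; rewrite setTI; apply: open_measurable_rV.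
by move/continuousP : cf; apply; exact: interval_open.
Qed.
End continuous_measurable.

(** * Gaussian integrals *)

Section phase_integral.
Context d (T : measurableType d) (R : realType).
Variable mu : {measure set T -> \bar R}.
Implicit Types th c h : T -> R.

Lemma integrable_cosM c h : measurable_fun setT c ->
  mu.-integrable setT (EFin \o h) ->
  mu.-integrable setT (EFin \o (fun x => cos (c x) * h x)).
Proof.
move=> mc ih; apply: (integrable_le _ (integrable_normr ih)).
  apply: measurable_funM; last exact: integrable_measurable ih.
  apply: (measurableT_comp (f := @cos R)) => //.
  by apply: continuous_measurable_fun; exact: continuous_cos.
by move=> x; rewrite normrM ler_piMl// ler_norml cos_geN1 cos_le1.
Qed.

Lemma sin_cosB (t : R) : sin t = cos (t - pi / 2).
Proof. by rewrite cosBpihalf. Qed.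

(* The phase [c] also covers the sine, as [sin s = cos (s - pi / 2)]. *)
Lemma is_derive_integral_cos th c h (t : R) :
  measurable_fun setT th -> measurable_fun setT c ->
  mu.-integrable setT (EFin \o h) ->
  mu.-integrable setT (EFin \o (fun x => th x * h x)) ->
  is_derive t 1 (fun t => \int[mu]_x (cos (c x + t * th x) * h x))
    (\int[mu]_x (- sin (c x + t * th x) * (th x * h x))).
Proof.
move=> mth mc ih ithh.
pose f (t : R) x := cos (c x + t * th x) * h x.
have mphase s : measurable_fun setT (fun x => c x + s * th x).
  by apply: measurable_funD => //; apply: measurable_funM.
have df s x : is_derive s (1:R) (f ^~ x) (- sin (c x + s * th x) * (th x * h x)).
  by apply: is_derive_eq; rewrite /GRing.scale/=; ring.
have d1f s x : partial1of2 f s x = - sin (c x + s * th x) * (th x * h x).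
  by rewrite partial1of2E (@derive_val _ _ _ _ _ _ _ (df s x)).
(* Any interval around [t] will do, because the dominating function [|th x * h x|] does not depend
   on the parameter. *)
have tI : `]t - 1, t + 1[%classic t by rewrite /= in_itv/= ltrBlDr ltrDl ltr01.
have bnd s x : `|partial1of2 f s x| <= `|th x * h x|.
  by rewrite d1f normrM ler_piMl// normrN ler_norml sin_geN1 sin_le1.
have := @cvg_differentiation_under_integral R _ T mu f setT measurableT t
  (t - 1) (t + 1) tI (fun s _ => integrable_cosM (mphase s) ih)
  (fun s x _ _ => @ex_derive _ _ _ _ _ _ _ (df s x)) (fun x => `|th x * h x|)
  (fun x => normr_ge0 _) (integrable_normr ithh) (fun s x _ _ => bnd s x).
have -> : \int[mu]_x partial1of2 f t x =
    \int[mu]_x (- sin (c x + t * th x) * (th x * h x)).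
  by apply: eq_Rintegral => x _; exact: d1f.
move=> F'.
have {}F' : h0^-1 *: ((fun t => \int[mu]_x f t x) (h0 *: 1 + t) -
    (fun t => \int[mu]_x f t x) t) @[h0 --> 0^'] -->
    \int[mu]_x (- sin (c x + t * th x) * (th x * h x)).
  by under eq_fun do rewrite scaler1.
split; first by apply/cvg_ex; eexists; exact: F'.
exact/cvg_lim.
Qed.

End phase_integral.

(** * One-dimensional Gaussian integrals *)

Section gauss1.
Variable R : realType.
Local Notation mu := (@lebesgue_measure R).
Implicit Types (q m t a b : R).

Definition gauss q t : R := expR (- (q * t ^+ 2)).

Lemma gauss_gt0 q t : 0 < gauss q t. Proof. exact: expR_gt0. Qed.

(** With variance 1 / (2q) the Gaussian is a multiple of a normal density, whose total mass 1 yields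
    the value sqrt (pi / q). *)
Lemma gauss_normal_pdf q m t : 0 < q ->
  gauss q (t - m) = Num.sqrt (pi / q) * normal_pdf m (Num.sqrt (2 * q)^-1) t.
Proof.
move=> q0; have q20 : 0 < (2 * q)^-1 by rewrite invr_gt0 mulr_gt0.
rewrite normal_pdfE ?gt_eqF ?sqrtr_gt0// /normal_peak /normal_fun /gauss.
rewrite sqr_sqrtr ?ltW//.
have -> : (2 * q)^-1 *+ 2 = q^-1 by rewrite -mulr_natl; field; rewrite gt_eqF.
have -> : (2 * q)^-1 * pi *+ 2 = pi / q by rewrite -mulr_natl; field; rewrite gt_eqF.
rewrite [RHS]mulrA mulfV ?mul1r; last by rewrite gt_eqF// sqrtr_gt0 divr_gt0// pi_gt0.
by rewrite invrK mulNr mulrC.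
Qed.

Lemma integrable_gauss q m : 0 < q ->
  mu.-integrable setT (EFin \o (fun t => gauss q (t - m))).
Proof.
move=> q0; under eq_fun do rewrite gauss_normal_pdf//.
by apply: integrableZr; exact: integrable_normal_pdf.
Qed.

Lemma Rintegral_gauss q m : 0 < q ->
  \int[mu]_t gauss q (t - m) = Num.sqrt (pi / q).
Proof.
move=> q0; under eq_Rintegral do rewrite gauss_normal_pdf//.
rewrite RintegralZl//; last exact: integrable_normal_pdf.
by rewrite /Rintegral integral_normal_pdf mulr1.
Qed.

Lemma continuous_gauss q : continuous (gauss q).
Proof.
move=> t; apply: (cvg_comp _ expR); last exact: continuous_expR.
apply: (@cvgN _ R^o); apply: cvgM; first exact: cvg_cst.
exact: sqr_continuous.
Qed.

Lemma measurable_gauss q : measurable_fun setT (gauss q).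
Proof. by apply: continuous_measurable_fun; exact: continuous_gauss. Qed.

(** Half of the exponent absorbs the factor |t|: with u = (q / 2) t^2 one has |t| <= 1 + t^2 = 1 +
    (2 / q) u <= (1 + 2 / q) (1 + u), and 1 + u <= e^u. *)
Lemma normr_mul_gauss_le q t : 0 < q ->
  `|t| * gauss q t <= (1 + 2 / q) * gauss (q / 2) t.
Proof.
move=> q0; have -> : gauss q t = gauss (q / 2) t * gauss (q / 2) t.
  by rewrite /gauss -expRD; congr expR; field.
rewrite mulrA ler_pM2r ?gauss_gt0//.
set u := q / 2 * t ^+ 2; have u0 : 0 <= u by rewrite mulr_ge0 ?sqr_ge0 ?divr_ge0 ?ltW.
have tu : `|t| <= 1 + 2 / q * u.
  have -> : 2 / q * u = `|t| ^+ 2.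
    by rewrite real_normK ?num_real// /u; field; rewrite gt_eqF.
  have := sqr_ge0 (`|t| - 1); have := normr_ge0 t; nra.
rewrite /gauss -/u expRN ler_pdivrMr ?expR_gt0//.
apply: (le_trans tu); apply: (@le_trans _ _ ((1 + 2 / q) * (1 + u))).
  have : 0 <= 2 / q by rewrite divr_ge0 ?ltW.
  nra.
rewrite ler_wpM2l ?expR_ge1Dx// addr_ge0// divr_ge0 ?ltW//.
Qed.

Lemma integrable_mul_gauss q : 0 < q ->
  mu.-integrable setT (EFin \o (fun t => t * gauss q t)).
Proof.
move=> q0; have q20 : 0 < q / 2 by rewrite divr_gt0.
have := integrableZr (1 + 2 / q) (integrable_gauss 0 q20).
under [in X in X -> _]eq_fun do rewrite subr0.
move=> /integrable_le; apply => [|t].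
  by apply: measurable_funM => //; exact: measurable_gauss.
rewrite normrM [`|gauss _ _|]ger0_norm; last exact/ltW/gauss_gt0.
exact: normr_mul_gauss_le.
Qed.

Lemma is_derive_gauss q t : is_derive t 1 (gauss q) (- (2 * q * t * gauss q t)).
Proof.
rewrite /gauss; apply: is_derive_eq; rewrite /GRing.scale/=; ring.
Qed.

(** For N = i + 1, e^(q N^2) >= q N^2 >= q N. All that matters is that the bound tends to 0. *)
Lemma gauss_le_harmonic q (i : nat) : 0 < q ->
  gauss q i.+1%:R <= q^-1 * harmonic i.
Proof.
move=> q0; rewrite /gauss expRN /harmonic -invfM lef_pV2 ?posrE ?expR_gt0 ?mulr_gt0//.
apply: (@le_trans _ _ (q * i.+1%:R ^+ 2)).
  by rewrite ler_pM2l// -natrX ler_nat expnS leq_pmulr// expn_gt0.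
by apply: le_trans (expR_ge1Dx _); rewrite lerDr.
Qed.

(* The boundary terms vanish along [-N, N] as N grows. *)
Lemma Rintegral_derive_gauss_eq0 q (F f : R -> R) : 0 < q ->
  (forall t, is_derive t 1 F (f t)) -> continuous f ->
  mu.-integrable setT (EFin \o f) ->
  (forall t, `|F t| <= gauss q t) -> \int[mu]_t f t = 0.
Proof.
move=> q0 F' cf intf Fgauss.
pose N (i : nat) : R := i.+1%:R.
have FTC i : \int[mu]_(t in `[- N i, N i]) f t = F (N i) - F (- N i).
  rewrite /Rintegral (@continuous_FTC2 _ _ F) //.
  - by rewrite -subr_gt0 opprK addr_gt0.
  - exact: continuous_subspaceT.
  - have cF t : {for t, continuous F}.
      by apply: differentiable_continuous; apply/derivable1_diffP.
    split; first by move=> t _; exact: ex_derive.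
      exact: cvg_at_right_filter (cF _).
    exact: cvg_at_left_filter (cF _).
  - by move=> t _; rewrite derive1E; exact: derive_val.
have lim1 : \int[mu]_(t in `[- N i, N i]) f t @[i --> \oo] --> \int[mu]_t f t.
  under eq_fun do rewrite Rintegral_mkcond.
  apply: (dominated_cvg_Rintegral _ _ (integrable_normr intf)).
  - move=> i; apply/(measurable_restrictT f) => //.
    by apply: measurable_funTS; exact: integrable_measurable intf.
  - move=> t; apply: cvg_near_cst.
    near=> i.
    rewrite patchE ifT// inE/= in_itv/= -ler_norml.
    rewrite (@le_trans _ _ i%:R) ?ler_nat//.
    by near: i; exact: nbhs_infty_ger.
  - by move=> i t; rewrite patchE; case: ifP => // _; rewrite normr0.
have lim0 : \int[mu]_(t in `[- N i, N i]) f t @[i --> \oo] --> 0.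
  under eq_fun do rewrite FTC.
  apply: norm_cvg0.
  apply: (@squeeze_cvgr _ _ _ _ (cst 0) (fun i => 2 * (q^-1 * harmonic i))).
  - apply: nearW => i; rewrite normr_ge0/=.
    apply: (le_trans (ler_normB _ _)); rewrite mulr_natl mulr2n.
    rewrite lerD//; apply: (le_trans (Fgauss _)).
      exact: gauss_le_harmonic.
    by rewrite /gauss sqrrN; exact: gauss_le_harmonic.
  - exact: cvg_cst.
  - have -> : (0 : R) = 2 * (q^-1 * 0) by rewrite !mulr0.
    by apply: cvgMl_tmp; apply: cvgMl_tmp; exact: cvg_harmonic.
exact: (cvg_unique _ lim1 lim0).
Unshelve. all: end_near. Qed.


(** Integration by parts: the derivative of sin (b + a t) e^(-q t^2) has integral 0. The left side
    is the derivative in [a] of the integral on the right, so this is the equation F' = - (a / (2q))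
    F. *)
Lemma Rintegral_gauss_ode q a b : 0 < q ->
  \int[mu]_t (- sin (b + a * t) * (t * gauss q t)) =
  - (a / (2 * q)) * \int[mu]_t (cos (b + a * t) * gauss q t).
Proof.
move=> q0; have mphase : measurable_fun setT (fun t => b + a * t).
  by apply: measurable_funD => //; apply: measurable_funM.
have ig : mu.-integrable setT (EFin \o gauss q).
  by have := integrable_gauss 0 q0; under eq_fun do rewrite subr0.
have icos := @integrable_cosM _ _ _ mu _ _ mphase ig.
have isin : mu.-integrable setT (EFin \o (fun t => - sin (b + a * t) * (t * gauss q t))).
  have mphase' : measurable_fun setT (fun t => b + a * t - pi / 2).
    by apply: measurable_funB.
  have := integrableZr (-1)
    (@integrable_cosM _ _ _ mu _ _ mphase' (integrable_mul_gauss q0)).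
  by under eq_fun do rewrite -sin_cosB mulrA mulN1r.
pose f t := a * (cos (b + a * t) * gauss q t) +
  2 * q * (- sin (b + a * t) * (t * gauss q t)).
have : \int[mu]_t f t = 0.
  apply: (@Rintegral_derive_gauss_eq0 q (fun t => sin (b + a * t) * gauss q t)) => //.
  - move=> t; have := is_derive_gauss q t => dg.
    by apply: is_derive_eq; rewrite /f /GRing.scale/=; ring.
  - move=> t; have cphase : {for t, continuous (fun t => b + a * t)}.
      by apply: cvgD; [exact: cvg_cst|apply: cvgMl_tmp; exact: cvg_id].
    apply: cvgD.
      apply: cvgMl_tmp; apply: cvgM; last exact: continuous_gauss.
      exact: (continuous_comp cphase (@continuous_cos R _)).
    apply: cvgMl_tmp; apply: cvgM.
      by apply: (@cvgN _ R^o); exact: (continuous_comp cphase (@continuous_sin R _)).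
    by apply: cvgM; [exact: cvg_id|exact: continuous_gauss].
  - by apply: integrableDr; apply: integrableZr.
  - move=> t; rewrite normrM [`|gauss _ _|]ger0_norm; last exact/ltW/gauss_gt0.
    by rewrite ler_piMl ?(ltW (gauss_gt0 _ _))// ler_norml sin_geN1 sin_le1.
rewrite RintegralD//; try exact: integrableZr.
rewrite !RintegralZl// => /eqP; rewrite addrC addr_eq0 => /eqP E.
apply: (mulfI (x := 2 * q)); first by rewrite gt_eqF ?mulr_gt0.
rewrite E; field; rewrite gt_eqF//.
Qed.

(** The differential equation makes F(a) e^(a^2 / (4q)) constant in [a], and at a = 0 the integral
    is the plain Gaussian one times cos b. The phase [b] lets the same formula give the sine
    integrals. *)
Lemma Rintegral_cos_gauss q a b : 0 < q ->
  \int[mu]_t (cos (b + a * t) * gauss q t) =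
  cos b * (Num.sqrt (pi / q) * expR (- (a ^+ 2 / (4 * q)))).
Proof.
move=> q0; pose F a := \int[mu]_t (cos (b + a * t) * gauss q t).
have ig : mu.-integrable setT (EFin \o gauss q).
  by have := integrable_gauss 0 q0; under eq_fun do rewrite subr0.
have dF s : is_derive s (1:R) F (- (s / (2 * q)) * F s).
  rewrite -Rintegral_gauss_ode//; apply: is_derive_integral_cos => //.
  exact: integrable_mul_gauss.
have q4 : 4 * q != 0 by rewrite gt_eqF ?mulr_gt0.
have : F a * expR (a ^+ 2 / (4 * q)) = F 0 * expR (0 ^+ 2 / (4 * q)).
  apply: (@is_derive_0_is_cst R (fun s => F s * expR (s ^+ 2 / (4 * q)))) => s.
  apply: is_derive_eq; rewrite /GRing.scale/=; field.
  by rewrite gt_eqF.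
rewrite expr0n mul0r expR0 mulr1 => FE.
apply: (mulIf (lt0r_neq0 (expR_gt0 (a ^+ 2 / (4 * q))))).
rewrite FE expRN -mulrA mulfVK ?gt_eqF ?expR_gt0// /F.
under eq_Rintegral do rewrite mul0r addr0.
rewrite RintegralZl//; congr (_ * _).
by rewrite -(Rintegral_gauss 0 q0); apply: eq_Rintegral => t _; rewrite subr0.
Qed.

End gauss1.

(** * Integrals of products h(v_0) H(v_1, ..., v_n) over R^(n+1) *)

Section product_integral.
Variables (R : realType) (n : nat).
Local Notation mu1 := (@lebesgue_measure R).
Local Notation mu := (lebesgue_rV R n).
Local Notation muS := (lebesgue_rV R n.+1).
Implicit Types (h : R -> R) (H : 'rV[R]_n -> R).

Local Notation tail v := (\row_j v 0 (lift ord0 j)).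

Let prod_fun h H (p : measurableTypeR R * 'rV[R]_n) : R := h p.1 * H p.2.

Let integrable_prod_fun h H :
  mu1.-integrable setT (EFin \o h) -> mu.-integrable setT (EFin \o H) ->
  (mu1 \x mu)%E.-integrable setT (EFin \o prod_fun h H).
Proof.
move=> ih iH; apply/integrable12ltyP.
  apply/measurable_EFinP; apply: measurable_funM.
    by apply: measurableT_comp; [exact: integrable_measurable ih|exact: measurable_fst].
  by apply: measurableT_comp; [exact: integrable_measurable iH|exact: measurable_snd].
rewrite /prod_fun/=.
under eq_integral => x _.
  under eq_integral => y _ do rewrite normrM EFinM.
  rewrite ge0_integralZl//; last first.
    apply/measurable_EFinP; apply: measurableT_comp => //.
    exact: integrable_measurable iH.
  over.
case/integrableP : iH => mH Hoo; case/integrableP : ih => mh hoo.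
under eq_integral do rewrite muleC.
rewrite ge0_integralZl//; last 2 first.
- by apply/measurable_EFinP; apply: measurableT_comp => //; apply/measurable_EFinP.
- exact: integral_ge0.
by rewrite lte_mul_pinfty// ?integral_ge0// ge0_fin_numE// integral_ge0.
Qed.

(** The measure on R^(n+1) is the image of a product measure under [cons_rV]; pulling the integrand
    back along this bijection leaves a product of functions of separate variables. *)
Lemma integrable_rVS h H :
  mu1.-integrable setT (EFin \o h) -> mu.-integrable setT (EFin \o H) ->
  muS.-integrable setT (EFin \o (fun v => h (v 0 0) * H (tail v))).
Proof.
move=> ih iH; have iP := integrable_prod_fun ih iH.
apply: (@integrable_pushforward _ _ _ _ _ _ (@measurable_cons_rV R n)
  (mu1 \x mu)%E setT (EFin \o (prod_fun h H \o @uncons_rV R n))) => //.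
- apply/measurable_EFinP; apply: measurableT_comp; last exact: measurable_uncons_rV.
  exact: integrable_measurable iP.
- rewrite preimage_setT (_ : _ \o _ = EFin \o prod_fun h H)//.
  by apply/funext => p /=; rewrite cons_rVK.
Qed.

Lemma Rintegral_rVS h H :
  mu1.-integrable setT (EFin \o h) -> mu.-integrable setT (EFin \o H) ->
  \int[muS]_v (h (v 0 0) * H (tail v)) = (\int[mu1]_t h t) * (\int[mu]_x H x).
Proof.
move=> ih iH; have iP := integrable_prod_fun ih iH.
have E : (EFin \o (prod_fun h H \o @uncons_rV R n)) \o @cons_rV R n =
    EFin \o prod_fun h H.
  by apply/funext => p /=; rewrite cons_rVK.
rewrite /Rintegral (@integral_pushforward _ _ _ _ _ _ (@measurable_cons_rV R n)
  (mu1 \x mu)%E setT (EFin \o (prod_fun h H \o @uncons_rV R n))) //; last 2 first.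
- apply/measurable_EFinP; apply: measurableT_comp; last exact: measurable_uncons_rV.
  exact: integrable_measurable iP.
- by rewrite preimage_setT E.
rewrite preimage_setT E -integral12_prod_meas1// /fubini_F /prod_fun/=.
under eq_integral => x _.
  under eq_integral => y _ do rewrite EFinM.
  rewrite integralZl// muleC; over.
rewrite -(fineK (integrable_fin_num measurableT iH)) integralZl//.
by rewrite -(fineK (integrable_fin_num measurableT ih)) -EFinM/= mulrC.
Qed.

End product_integral.

(** * Gaussian integrals on R^n, by induction on the dimension *)

Section gauss_rV.
Variable R : realType.

Definition gaussV n (q : R) (x : 'rV[R]_n) : R := expR (- (q * dotp x x)).

Lemma dotp_rVS n (x y : 'rV[R]_n.+1) : dotp x y = x 0 0 * y 0 0 +
  dotp (\row_j x 0 (lift ord0 j)) (\row_j y 0 (lift ord0 j)).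
Proof.
by rewrite /dotp big_ord_recl; congr (_ + _); apply: eq_bigr => i _; rewrite !mxE.
Qed.

Lemma gaussV_rVS n (q : R) (x a : 'rV[R]_n.+1) : gaussV q (x - a) =
  gauss q (x 0 0 - a 0 0) *
  gaussV q (\row_j x 0 (lift ord0 j) - \row_j a 0 (lift ord0 j)).
Proof.
rewrite /gaussV /gauss -expRD -opprD -mulrDr expr2 dotp_rVS !mxE.
rewrite (_ : \row_j (x - a) 0 (lift ord0 j) =
  \row_j x 0 (lift ord0 j) - \row_j a 0 (lift ord0 j))//.
by apply/rowP => j; rewrite !mxE.
Qed.

Lemma Rintegral_rV0 (f : 'rV[R]_0 -> R) : measurable_fun setT f ->
  \int[lebesgue_rV R 0]_x f x = f 0.
Proof.
move=> mf; rewrite /Rintegral integral_dirac//; last exact/measurable_EFinP.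
by rewrite diracE mem_set// mul1e.
Qed.

Lemma measurable_gaussV n q a :
  measurable_fun setT (fun x : 'rV[R]_n => gaussV q (x - a)).
Proof.
apply: (measurableT_comp (@measurable_expR R)); apply: measurableT_comp => //.
apply: measurable_funM => //; apply: measurable_sum => i.
by apply: measurable_funM; under eq_fun do rewrite mxE;
  apply: measurable_funD => //; exact: measurable_coord.
Qed.

Lemma integrable_gaussV n q a : 0 < q ->
  (lebesgue_rV R n).-integrable setT (EFin \o (fun x => gaussV q (x - a))).
Proof.
move=> q0; elim: n a => [|n IH] a.
  apply/integrableP; split; first by apply/measurable_EFinP; exact: measurable_gaussV.
  rewrite integral_dirac//; last first.
    by apply: measurableT_comp => //; apply/measurable_EFinP; exact: measurable_gaussV.
  by rewrite diracE mem_set// mul1e ltry.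
under eq_fun do rewrite gaussV_rVS.
apply: (integrable_rVS (h := fun t => gauss q (t - a 0 0))
  (H := fun v => gaussV q (v - \row_j a 0 (lift ord0 j)))) => //.
exact: integrable_gauss.
Qed.

Lemma Rintegral_gaussV n q a : 0 < q ->
  \int[lebesgue_rV R n]_x gaussV q (x - a) = Num.sqrt (pi / q) ^+ n.
Proof.
move=> q0; elim: n a => [|n IH] a.
  rewrite Rintegral_rV0; last exact: measurable_gaussV.
  by rewrite /gaussV /dotp big_ord0 mulr0 oppr0 expR0 expr0.
under eq_Rintegral do rewrite gaussV_rVS.
rewrite (Rintegral_rVS (h := fun t => gauss q (t - a 0 0))
  (H := fun v => gaussV q (v - \row_j a 0 (lift ord0 j)))).
- by rewrite IH Rintegral_gauss// exprS.
- exact: integrable_gauss.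
- exact: integrable_gaussV.
Qed.

Lemma Rintegral_cos_gaussV n q a b : 0 < q ->
  \int[lebesgue_rV R n]_x (cos (b + dotp a x) * gaussV q x) =
  cos b * (Num.sqrt (pi / q) ^+ n * expR (- (dotp a a / (4 * q)))).
Proof.
move=> q0; elim: n a b => [|n IH] a b.
  rewrite Rintegral_rV0; last first.
    apply: measurable_funM; last first.
      by have := @measurable_gaussV 0 q 0; under eq_fun do rewrite subr0.
    apply: (measurableT_comp (f := @cos R)).
      by apply: continuous_measurable_fun; exact: continuous_cos.
    by apply: measurable_funD => //; exact: measurable_dotp.
  by rewrite /gaussV /dotp !big_ord0 mulr0 mul0r oppr0 expR0 expr0 !mulr1 addr0.
pose a' := \row_j a 0 (lift ord0 j).
pose c1 b t := cos (b + a 0 0 * t) * gauss q t.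
pose c2 b (v : 'rV[R]_n) := cos (b + dotp a' v) * gaussV q v.
have i1 d : lebesgue_measure.-integrable setT (EFin \o c1 d).
  apply: integrable_cosM.
    by apply: measurable_funD => //; apply: measurable_funM.
  by have := integrable_gauss 0 q0; under eq_fun do rewrite subr0.
have i2 d : (lebesgue_rV R n).-integrable setT (EFin \o c2 d).
  apply: integrable_cosM.
    by apply: measurable_funD => //; exact: measurable_dotp.
  by have := @integrable_gaussV n _ 0 q0; under eq_fun do rewrite subr0.
(* The addition formula for the cosine separates the first coordinate, with the sines written as
   cosines of phase - pi / 2. The second product will integrate to 0 because of its factor cos (- pi
   / 2). *)
transitivity (\int[lebesgue_rV R n.+1]_x
    (c1 0 (x 0 0) * c2 b (\row_j x 0 (lift ord0 j)) -
     c1 (- (pi / 2)) (x 0 0) * c2 (b - pi / 2) (\row_j x 0 (lift ord0 j)))).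
  apply: eq_Rintegral => x _; rewrite /c1 /c2 -[in LHS](subr0 x) gaussV_rVS.
  rewrite (_ : \row_j (0 : 'rV[R]_n.+1) 0 (lift ord0 j) = 0); last first.
    by apply/rowP => j; rewrite !mxE.
  rewrite mxE !subr0 dotp_rVS add0r.
  rewrite [- (pi / 2) + _]addrC -sin_cosB.
  rewrite [b - pi / 2 + _]addrAC -sin_cosB.
  rewrite (_ : b + _ =
    a 0 0 * x 0 0 + (b + dotp a' (\row_j x 0 (lift ord0 j)))); last first.
    by rewrite addrCA.
  by rewrite [in LHS]cosD; ring.
rewrite RintegralB//; try exact: integrable_rVS.
rewrite !Rintegral_rVS// IH !Rintegral_cos_gauss// cosN cos_pihalf !mul0r subr0.
rewrite cos0 mul1r expr2 exprS dotp_rVS (mulrDl _ _ (4 * q)^-1) opprD expRD -/a'.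
by ring.
Qed.

End gauss_rV.

(** * Modulated Gaussians are Schwartz functions *)

Section line_derivative.
Variables (R : realType) (n : nat).
Local Notation Rn := 'rV[R]_n.
Implicit Types (f g : Rn -> R[i]) (x v : Rn) (l : R[i]).

(** The two difference quotients coincide, so partial derivatives reduce to calculus in one
    variable. *)
Lemma is_derive_line (f : Rn -> R) x v (l : R) :
  is_derive (0 : R) 1 (fun t => f (t *: v + x)) l -> is_derive x v f l.
Proof.
move=> [df <-]; have E : (fun h => h^-1 *: ((f \o shift x) (h *: v) - f x)) =
    (fun h => h^-1 *: (((fun t => f (t *: v + x)) \o shift 0) (h *: 1) -
      (fun t => f (t *: v + x)) 0)).
  by apply/funext => h /=; rewrite addr0 scaler1 scale0r add0r.
by split; rewrite /derivable /derive E.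
Qed.

Definition is_cderive x v f l :=
  is_derive x v (@complex.Re R \o f) (complex.Re l) /\
  is_derive x v (@complex.Im R \o f) (complex.Im l).

Lemma is_cderiveD x v f g l k : is_cderive x v f l -> is_cderive x v g k ->
  is_cderive x v (fun x => f x + g x) (l + k).
Proof.
move=> [fr fi] [gr gi]; split.
- rewrite cReD (_ : _ \o _ = (@complex.Re R \o f) + (@complex.Re R \o g)).
    exact: is_deriveD.
  by apply/funext => y; exact: cReD.
- rewrite cImD (_ : _ \o _ = (@complex.Im R \o f) + (@complex.Im R \o g)).
    exact: is_deriveD.
  by apply/funext => y; exact: cImD.
Qed.

Lemma is_cderiveM x v f g l k : is_cderive x v f l -> is_cderive x v g k ->
  is_cderive x v (fun x => f x * g x) (l * g x + f x * k).
Proof.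
move=> [fr fi] [gr gi]; split.
- rewrite (_ : _ \o _ = (@complex.Re R \o f) * (@complex.Re R \o g) -
      (@complex.Im R \o f) * (@complex.Im R \o g)); last first.
    by apply/funext => y; exact: cReM.
  by apply: is_derive_eq; rewrite cReD !cReM /GRing.scale/=; ring.
- rewrite (_ : _ \o _ = (@complex.Re R \o f) * (@complex.Im R \o g) +
      (@complex.Im R \o f) * (@complex.Re R \o g)); last first.
    by apply/funext => y; exact: cImM.
  by apply: is_derive_eq; rewrite cImD !cImM /GRing.scale/=; ring.
Qed.

Lemma is_cderive_cst x v (c : R[i]) : is_cderive x v (fun=> c) 0.
Proof. by split; exact: is_derive_cst. Qed.

Lemma is_cderive_coord x v j : is_cderive x v (fun x => (x 0 j)%:C) (v 0 j)%:C.
Proof.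
split; last exact: is_derive_cst.
apply: is_derive_line; rewrite /=.
under eq_fun do rewrite !mxE.
by apply: is_derive_eq; rewrite /GRing.scale/= mulr0 mulr1 add0r addr0.
Qed.

(** The second conclusion is an equality of functions, so that it can be rewritten inside iterated
    derivatives. *)
Lemma is_cderive_partial f f' i :
  (forall x, is_cderive x (basis_vec i) f (f' x)) ->
  has_partial i f /\ partial i f = f'.
Proof.
move=> df; split=> [x|]; first by have [fr fi] := df x; split; exact: ex_derive.
apply/funext => x; have [fr fi] := df x.
by apply: complexP; [exact: derive_val|exact: derive_val].
Qed.

Lemma continuous_dotp (a : Rn) : continuous (dotp a).
Proof.
move=> x; apply: (@cvg_big _ _ _ _ _ _ _ (nbhs x)) => [|i _]; first exact: add_continuous.
apply: cvgMl_tmp.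
exact: coord_continuous.
Qed.

Lemma continuous_dotpxx : continuous (fun x : Rn => dotp x x).
Proof.
move=> x; apply: (@cvg_big _ _ _ _ _ _ _ (nbhs x)) => [|i _]; first exact: add_continuous.
by apply: cvgM; exact: coord_continuous.
Qed.

End line_derivative.

(** * Derivatives and decay of modulated Gaussians *)

Section schwartz_gauss.
Variables (R : realType) (n : nat).
Local Notation Rn := 'rV[R]_n.
Local Notation F := (Rn -> R[i]).
Variables (a : Rn) (q : R).
Hypothesis q_gt0 : 0 < q.

Definition mgauss : F := fun xi => expi (dotp a xi) * (gaussV q xi)%:C.

(** The polynomial multiples of [mgauss], given by closure rules: stability under partial
    derivatives and decay bounds then follow by induction, with no polynomials in several
    variables. *)
Inductive poly_gauss : F -> Prop :=
| poly_gauss1 : poly_gauss mgauss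
| poly_gaussD f g : poly_gauss f -> poly_gauss g ->
    poly_gauss (fun x => f x + g x)
| poly_gaussZ c f : poly_gauss f -> poly_gauss (fun x => c * f x)
| poly_gaussX j f : poly_gauss f -> poly_gauss (fun x => (x 0 j)%:C * f x).

Lemma is_cderive_mgauss x i : is_cderive x (basis_vec i) mgauss
  ((0 +i* a 0 i) * mgauss x + (- (2 * q))%:C * ((x 0 i)%:C * mgauss x)).
Proof.
have -> : (0 +i* a 0 i) * mgauss x + (- (2 * q))%:C * ((x 0 i)%:C * mgauss x) =
    ((0 +i* a 0 i) * expi (dotp a x)) * (gaussV q x)%:C +
    expi (dotp a x) * ((- (2 * q) * x 0 i) * gaussV q x)%:C.
  by rewrite /mgauss; apply: complexP; rewrite ?cReD ?cImD ?cReM ?cImM/=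
    ?cReM ?cImM/=; ring.
have E t : dotp a (t *: basis_vec i + x) = t * a 0 i + dotp a x.
  by rewrite dotpC dotpDl dotpZl dotp_basis_vec dotpC.
apply: is_cderiveM.
- split; apply: is_derive_line; rewrite /=; under eq_fun do rewrite E;
  by apply: is_derive_eq; rewrite ?cReM ?cImM/= /GRing.scale/= mul0r add0r; ring.
- split; last exact: is_derive_cst.
  apply: is_derive_line; rewrite /= /gaussV.
  have E2 t : dotp (t *: basis_vec i + x) (t *: basis_vec i + x) =
      t ^+ 2 + 2 * t * x 0 i + dotp x x.
    rewrite !dotpDl !dotpZl !(dotpC _ (t *: basis_vec i + x)) !dotpDl !dotpZl.
    by rewrite !dotp_basis_vec (dotpC x) dotp_basis_vec mxE !eqxx/=; ring.
  under eq_fun do rewrite E2.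
  apply: is_derive_eq; rewrite /GRing.scale/= expr0n !mulr0 !mul0r !add0r.
  ring.
Qed.

Lemma poly_gauss_partial f i : poly_gauss f ->
  exists2 f', poly_gauss f' & forall x, is_cderive x (basis_vec i) f (f' x).
Proof.
elim=> [|g h _ [g' Gg' dg] _ [h' Gh' dh]|c g _ [g' Gg' dg]|j g Gg [g' Gg' dg]].
- eexists; last by move=> x; exact: is_cderive_mgauss.
  apply: poly_gaussD; apply: poly_gaussZ; first exact: poly_gauss1.
  by apply: poly_gaussX; exact: poly_gauss1.
- exists (fun x => g' x + h' x); first exact: poly_gaussD.
  by move=> x; exact: is_cderiveD.
- exists (fun x => c * g' x); first exact: poly_gaussZ.
  move=> x; have := is_cderiveM (is_cderive_cst x (basis_vec i) c) (dg x).
  by rewrite mul0r add0r.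
- exists (fun x => (basis_vec i 0 j)%:C * g x + (x 0 j)%:C * g' x).
    by apply: poly_gaussD; [exact: poly_gaussZ|exact: poly_gaussX].
  by move=> x; exact: is_cderiveM (is_cderive_coord _ _ _) (dg x).
Qed.

Lemma ccontinuousD (f g : F) : ccontinuous f -> ccontinuous g ->
  ccontinuous (fun x => f x + g x).
Proof.
move=> [fr fi] [gr gi]; split => x.
- rewrite (_ : _ \o _ = fun x => complex.Re (f x) + complex.Re (g x)).
    exact: (cvgD (fr x) (gr x)).
  by apply/funext => y; exact: cReD.
- rewrite (_ : _ \o _ = fun x => complex.Im (f x) + complex.Im (g x)).
    exact: (cvgD (fi x) (gi x)).
  by apply/funext => y; exact: cImD.
Qed.

Lemma ccontinuousM (f g : F) : ccontinuous f -> ccontinuous g ->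
  ccontinuous (fun x => f x * g x).
Proof.
move=> [fr fi] [gr gi]; split => x.
- rewrite (_ : _ \o _ = fun x => complex.Re (f x) * complex.Re (g x) -
      complex.Im (f x) * complex.Im (g x)).
    exact: (cvgB (cvgM (fr x) (gr x)) (cvgM (fi x) (gi x))).
  by apply/funext => y; exact: cReM.
- rewrite (_ : _ \o _ = fun x => complex.Re (f x) * complex.Im (g x) +
      complex.Im (f x) * complex.Re (g x)).
    exact: (cvgD (cvgM (fr x) (gi x)) (cvgM (fi x) (gr x))).
  by apply/funext => y; exact: cImM.
Qed.

Lemma poly_gauss_continuous f : poly_gauss f -> ccontinuous f.
Proof.
elim=> [|g h _ cg _ ch|c g _ cg|j g _ cg].
- apply: ccontinuousM; split => x.
  + exact: (continuous_comp (@continuous_dotp R n a x) (@continuous_cos R _)).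
  + exact: (continuous_comp (@continuous_dotp R n a x) (@continuous_sin R _)).
  + have cq : {for x, continuous (fun y : Rn => - (q * dotp y y))}.
      by apply: continuousN; exact: (cvgMl_tmp (@continuous_dotpxx R n x)).
    exact: (continuous_comp cq (@continuous_expR R _)).
  + exact: cst_continuous.
- exact: ccontinuousD.
- by apply: ccontinuousM => //; split => x; exact: cst_continuous.
- apply: ccontinuousM => //; split => x; last exact: cst_continuous.
  exact: coord_continuous.
Qed.

Lemma poly_gauss_Ck k f : poly_gauss f -> Ck k f.
Proof.
elim: k f => [|k IH] f Gf; split => //; try exact: poly_gauss_continuous.
move=> i; have [f' Gf' df] := poly_gauss_partial i Gf.
by have [? ->] := is_cderive_partial df; split => //; exact: IH.
Qed.

Lemma poly_gauss_mpartial al f : poly_gauss f -> poly_gauss (mpartial al f).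
Proof.
move=> Gf; rewrite /mpartial; elim: (enum _) => //= i s IH.
elim: (al i) => //= m IHm; have [f' Gf' df] := poly_gauss_partial i IHm.
by have [_ ->] := is_cderive_partial df.
Qed.

Lemma poly_gauss_le f : poly_gauss f -> exists C m, 0 <= C /\
  forall x, cabs (f x) <= C * japanese x ^+ m * gaussV q x.
Proof.
elim=> [|g h _ [C [m [C0 gC]]] _ [D [p [D0 hD]]]|c g _ [C [m [C0 gC]]]|
    j g _ [C [m [C0 gC]]]].
- exists 1, 0%N; split => // x.
  by rewrite expr0 !mul1r normcM normc_expi mul1r normcC ger0_norm ?expR_ge0.
- exists (C + D), (m + p)%N; split=> [|x]; first exact: addr_ge0.
  apply: (le_trans (@le_normcD _ (g x) (h x))).
  apply: (le_trans (lerD (gC x) (hD x))).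
  rewrite -mulrDl ler_pM2r ?expR_gt0// mulrDl.
  by rewrite lerD// ler_wpM2l// ler_weXn2l ?japanese_ge1// ?leq_addr// leq_addl.
- exists (cabs c * C), m; split=> [|x]; first by rewrite mulr_ge0 ?normc_ge0.
  by rewrite normcM -!mulrA ler_wpM2l ?normc_ge0// mulrA.
- exists C, m.+1; split => // x; rewrite normcM normcC exprS mulrCA -mulrA.
  rewrite -mulrA ler_pM ?normc_ge0 ?coord_le_japanese//.
  by rewrite mulrA.
Qed.

(** The bound comes from y^(m+1) / (m+1)! <= e^y at y = q <x>^2 = q + q |x|^2, together with <x>^m
    <= <x>^(2(m+1)). The factor e^q pays for the 1 in <x>^2 = 1 + |x|^2. *)
Lemma japaneseX_gauss_bounded m : exists M, forall x : Rn,
  japanese x ^+ m * gaussV q x <= M.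
Proof.
exists (q ^- m.+1 * (m.+1)`!%:R * expR q) => x.
set j := japanese x.
have j1 : 1 <= j := japanese_ge1 x.
have j2 : q * j ^+ 2 = q + q * dotp x x.
  by rewrite sqr_sqrtr ?addr_ge0 ?sqr_ge0// sqr_enorm mulrDr mulr1.
have F0 : (m.+1)`!%:R != 0 :> R by rewrite pnatr_eq0 -lt0n fact_gt0.
have y0 : 0 <= q * j ^+ 2 by rewrite mulr_ge0 ?sqr_ge0// ltW.
have key : (q * j ^+ 2) ^+ m.+1 / m.+1`!%:R <= expR (q * j ^+ 2).
  apply: le_trans (expR_ge1Dxn m y0). by rewrite lerDr.
rewrite /gaussV expRN ler_pdivrMr ?expR_gt0// -[leRHS]mulrA -expRD -j2.
apply: (@le_trans _ _ (q ^- m.+1 * (m.+1)`!%:R * ((q * j ^+ 2) ^+ m.+1 / m.+1`!%:R))).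
  rewrite exprMn -exprM.
  have -> : q ^- m.+1 * (m.+1)`!%:R * (q ^+ m.+1 * j ^+ (2 * m.+1) / (m.+1)`!%:R) =
      j ^+ (2 * m.+1).
    by field; rewrite F0 expf_neq0// gt_eqF.
  by rewrite ler_weXn2l// mul2n -addnn (leq_trans (leqnSn m))// leq_addl.
rewrite ler_wpM2l// mulr_ge0// invr_ge0 exprn_ge0// ltW//.
Qed.

Lemma schwartz_mgauss : schwartz mgauss.
Proof.
split=> [k|al m]; first exact/poly_gauss_Ck/poly_gauss1.
have [C [p [C0 fC]]] := poly_gauss_le (poly_gauss_mpartial al poly_gauss1).
have [M gM] := japaneseX_gauss_bounded (m + p).
apply: (@le_lt_trans _ _ (C * M)%:E); last exact: ltry.
apply: ge_ereal_sup => _ [x _ <-]; rewrite lee_fin normcM normcC.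
rewrite ger0_norm ?exprn_ge0 ?(le_trans ler01 (japanese_ge1 _))//.
apply: (@le_trans _ _ (C * (japanese x ^+ (m + p) * gaussV q x))).
  rewrite exprD -mulrA mulrCA ler_wpM2l ?exprn_ge0 ?(le_trans ler01 (japanese_ge1 _))//.
  by rewrite mulrA.
by rewrite ler_wpM2l.
Qed.

End schwartz_gauss.

(** * Fourier inversion *)

Section gauss_mean.
Variables (R : realType) (n : nat).
Local Notation Rn := 'rV[R]_n.
Local Notation mu := (lebesgue_rV R n).
Variables (u : Rn -> R) (M : R).
Hypotheses (cu : continuous u) (uM : forall y, `|u y| <= M).

(** The convolution of [u] with a Gaussian normalised to total mass 1, which concentrates at [x] as
    [r] grows. *)
Definition gauss_mean (r : R) (x : Rn) : R :=
  Num.sqrt (r / pi) ^+ n * \int[mu]_y (u y * gaussV r (y - x)).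

Lemma integrable_mul_gaussV r x : 0 < r ->
  mu.-integrable setT (EFin \o (fun y => u y * gaussV r (y - x))).
Proof.
move=> r0; apply: (integrable_le _ (integrableZr M (integrable_gaussV x r0))).
  apply: measurable_funM; last exact: measurable_gaussV.
  exact: continuous_measurable_rV.
by move=> y; rewrite normrM [`|gaussV _ _|]ger0_norm ?expR_ge0// ler_wpM2r ?expR_ge0.
Qed.

Lemma gaussV_half r (z : Rn) : gaussV r z = gaussV (r / 2) z * gaussV (r / 2) z.
Proof. by rewrite /gaussV -expRD; congr expR; field. Qed.

(* Near [x] the oscillation of [u] is small; away from [x] half of the
   exponent already makes the Gaussian small. *)
Lemma gauss_mean_le r x eta delta : 0 < r -> 0 <= eta -> 0 <= delta ->
  (forall y, enorm (y - x) < delta -> `|u y - u x| <= eta) ->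
  `|gauss_mean r x - u x| <=
    eta + 2 * M * expR (- (r / 2 * delta ^+ 2)) * Num.sqrt 2 ^+ n.
Proof.
move=> r0 eta0 delta0 osc; have r20 : 0 < r / 2 by rewrite divr_gt0.
have M0 : 0 <= M := le_trans (normr_ge0 _) (uM 0).
have pi0 := pi_gt0 R; set N := Num.sqrt (r / pi) ^+ n.
have N0 : 0 <= N by rewrite exprn_ge0.
have iG := integrable_gaussV x r0; have iu := integrable_mul_gaussV x r0.
have E1 (p : R) : 0 < p -> r / p * (p / r) = 1.
  by move=> p0; field; rewrite (gt_eqF r0) (gt_eqF p0).
have E2 (p : R) : 0 < p -> r / p * (p / (r / 2)) = 2.
  by move=> p0; field; rewrite (gt_eqF r0) (gt_eqF p0).
have NG : N * \int[mu]_y gaussV r (y - x) = 1.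
  rewrite Rintegral_gaussV// -exprMn -sqrtrM ?divr_ge0 ?ltW//.
  by rewrite E1// sqrtr1 expr1n.
(* Halving the exponent multiplies the total mass by sqrt 2 in each dimension. *)
have NG2 : N * \int[mu]_y gaussV (r / 2) (y - x) = Num.sqrt 2 ^+ n.
  by rewrite Rintegral_gaussV// -exprMn -sqrtrM ?divr_ge0 ?ltW// E2.
have -> : gauss_mean r x - u x =
    N * \int[mu]_y (u y * gaussV r (y - x) - u x * gaussV r (y - x)).
  rewrite RintegralB//; last exact: integrableZr.
  by rewrite RintegralZl// mulrBr mulrCA NG mulr1.
rewrite normrM (ger0_norm N0).
pose K := 2 * M * expR (- (r / 2 * delta ^+ 2)).
have iH : mu.-integrable setT (EFin \o (fun y => eta * gaussV r (y - x) +
    K * gaussV (r / 2) (y - x))).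
  by apply: integrableDr; apply: integrableZr => //; exact: integrable_gaussV.
have iB := integrableBr iu (integrableZr (u x) iG).
apply: (@le_trans _ _ (N * \int[mu]_y (eta * gaussV r (y - x) +
    K * gaussV (r / 2) (y - x)))); last first.
  rewrite RintegralD//; try by apply: integrableZr => //; exact: integrable_gaussV.
  rewrite !RintegralZl//; try exact: integrable_gaussV.
  by rewrite mulrDr ![N * (_ * _)]mulrCA NG NG2 mulr1.
rewrite ler_wpM2l//; apply: (le_trans (le_normr_Rintegral measurableT iB)).
apply: le_Rintegral => //; first exact: integrable_normr.
move=> y _; rewrite -mulrBl normrM [`|gaussV _ _|]ger0_norm ?expR_ge0//.
have [yx|yx] := ltP (enorm (y - x)) delta.
  rewrite -[leLHS]addr0 lerD// ?ler_wpM2r ?expR_ge0 ?osc//.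
  by rewrite !mulr_ge0 ?expR_ge0.
rewrite -[leLHS]add0r lerD// ?mulr_ge0 ?expR_ge0//.
rewrite gaussV_half mulrA ler_pM ?mulr_ge0 ?expR_ge0//.
apply: ler_pM; rewrite ?expR_ge0//.
  by apply: (le_trans (ler_normB _ _)); rewrite mulr_natl mulr2n lerD.
by rewrite ler_expR lerN2 ler_pM2l// -sqr_enorm lerXn2r ?nnegrE ?enorm_ge0.
Qed.

(** The parameter (m + 1) / 4 is 1 / (4q) for q = 1 / (m + 1), the one that the Fourier transform of
    [mgauss x q] carries. *)
Lemma cvg_gauss_mean x : gauss_mean (m.+1%:R / 4) x @[m --> \oo] --> u x.
Proof.
apply/cvgrPdist_le => e e0; have e20 : 0 < e / 2 by rewrite divr_gt0.
have /cvgrPdist_le/(_ _ e20)/nbhs_ballP[delta /= delta0 osc] := @cu x.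
(* For r = (m + 1) / 4 the exponent (r / 2) delta^2 of the tail is c (m + 1), and e^(- c (m + 1)) <=
   1 / (c (m + 1)). *)
pose c := delta ^+ 2 / 8.
have c0 : 0 < c by rewrite divr_gt0 ?exprn_gt0.
have tail0 : 2 * M * (c^-1 * harmonic m) * Num.sqrt 2 ^+ n @[m --> \oo] --> 0.
  have -> : (0 : R) = 2 * M * (c^-1 * 0) * Num.sqrt 2 ^+ n by rewrite !mulr0 mul0r.
  apply: cvgMr_tmp; apply: cvgMl_tmp; apply: cvgMl_tmp; exact: cvg_harmonic.
have /cvgrPdist_le/(_ _ e20) tail := tail0.
near=> m; rewrite distrC.
apply: (le_trans (@gauss_mean_le (m.+1%:R / 4) x (e / 2) delta _ _ _ _)).
- by rewrite divr_gt0.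
- exact: ltW.
- exact: ltW.
- move=> y yx; rewrite distrC; apply: osc; apply/ball_rVE; split => // i.
  apply: le_lt_trans yx; rewrite distrC.
  by have := coord_le_enorm i (y - x); rewrite !mxE.
rewrite [leRHS]splitr lerD2l.
have : `|0 - 2 * M * (c^-1 * harmonic m) * Num.sqrt 2 ^+ n| <= e / 2 by near: m.
rewrite sub0r normrN; apply: le_trans; apply: le_trans (ler_norm _).
rewrite ler_wpM2r ?exprn_ge0// ler_wpM2l//.
  by rewrite mulr_ge0// (le_trans _ (uM 0)).
rewrite expRN /harmonic -invfM lef_pV2 ?posrE ?expR_gt0 ?mulr_gt0//.
apply: le_trans (expR_ge1Dx _).
have -> : m.+1%:R / 4 / 2 * delta ^+ 2 = c * m.+1%:R by rewrite /c; field.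
by rewrite lerDr.
Unshelve. all: end_near. Qed.

End gauss_mean.

(** * The inversion formula *)

Section inversion.
Variables (R : realType) (n : nat).
Local Notation Rn := 'rV[R]_n.
Local Notation F := (Rn -> R[i]).
Local Notation mu := (lebesgue_rV R n).
Implicit Types (f g : F) (x y : Rn) (q : R).

(** The kernel and the modulation combine into the single phase (x - y).t, which centres the
    transform at [x]; the sine part vanishes because it carries the factor cos (- pi / 2). *)
Lemma fourier_mgauss q x y : 0 < q -> fourier (mgauss x q) y =
  (Num.sqrt (pi / q) ^+ n * gaussV (4 * q)^-1 (y - x))%:C.
Proof.
move=> q0; have E t : expi (- dotp t y) * mgauss x q t =
    (cos (dotp (x - y) t) * gaussV q t) +i* (sin (dotp (x - y) t) * gaussV q t).
  rewrite /mgauss mulrA -expiD dotpBl (dotpC t y) [- _ + _]addrC.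
  by apply: complexP; rewrite ?cReM ?cImM/= mulr0 ?subr0 ?add0r.
have G : gaussV (4 * q)^-1 (y - x) = expR (- (dotp (x - y) (x - y) / (4 * q))).
  by rewrite /gaussV -(opprB x y) dotpNl dotpNr opprK mulrC.
rewrite /fourier; under eq_fun do rewrite E.
apply: complexP => /=.
- transitivity (\int[mu]_t (cos (0 + dotp (x - y) t) * gaussV q t)).
    by apply: eq_Rintegral => t _; rewrite add0r.
  by rewrite Rintegral_cos_gaussV// cos0 mul1r G.
- transitivity (\int[mu]_t (cos (- (pi / 2) + dotp (x - y) t) * gaussV q t)).
    by apply: eq_Rintegral => t _; rewrite [- _ + _]addrC -sin_cosB.
  by rewrite Rintegral_cos_gaussV// cosN cos_pihalf mul0r.
Qed.

Lemma gaussV_le1 q x : 0 <= q -> gaussV q x <= 1.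
Proof.
by move=> q0; rewrite /gaussV -[leRHS]expR0 ler_expR oppr_le0 mulr_ge0// dotp_ge0.
Qed.

Lemma cvg_gaussV x : gaussV (m.+1%:R^-1) x @[m --> \oo] --> (1 : R).
Proof.
rewrite -[X in _ --> X](@expR0 R).
apply: (cvg_comp _ expR); last exact: continuous_expR.
have -> : (0 : R) = - (0 * dotp x x) by rewrite mul0r oppr0.
by apply: (@cvgN _ R^o); apply: cvgMr_tmp; exact: cvg_harmonic.
Qed.

Lemma cvg_Rintegral_gaussV (u : Rn -> R) :
  mu.-integrable setT (EFin \o u) ->
  \int[mu]_x (u x * gaussV (m.+1%:R^-1) x) @[m --> \oo] --> \int[mu]_x u x.
Proof.
move=> iu; apply: (dominated_cvg_Rintegral _ _ (integrable_normr iu)).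
- move=> m; apply: measurable_funM; first exact: integrable_measurable iu.
  by have := @measurable_gaussV R n m.+1%:R^-1 0; under eq_fun do rewrite subr0.
- move=> x; rewrite -[X in _ --> X]mulr1.
  by apply: cvgMl_tmp; exact: cvg_gaussV.
- move=> m x; rewrite normrM ler_piMr// ger0_norm ?expR_ge0// gaussV_le1//.
Qed.

(* Both sides are limits of the duality between [f] and the Gaussian
   [mgauss x q] as [q] tends to 0. *)
Lemma fourier_inversion f g (M : R) x : ccontinuous f ->
  (forall y, cabs (f y) <= M) -> is_fourierL1 f g ->
  ((2 * pi) ^+ n)%:C * f x = cintegral (fun xi => expi (dotp x xi) * g xi).
Proof.
move=> [cfr cfi] fM [ig fg].
pose q m : R := m.+1%:R^-1.
have q0 m : 0 < q m by rewrite invr_gt0.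
have frM y : `|(@complex.Re R \o f) y| <= M := le_trans (normr_Re_le _) (fM y).
have fiM y : `|(@complex.Im R \o f) y| <= M := le_trans (normr_Im_le _) (fM y).
(* The origin of (2 pi)^n: it is the ratio of the constant in [fourier_mgauss] to the normalisation
   of [gauss_mean] at r = 1 / (4q). *)
have K m : Num.sqrt (pi / q m) ^+ n = (2 * pi) ^+ n * Num.sqrt (m.+1%:R / 4 / pi) ^+ n.
  rewrite -exprMn; congr (_ ^+ n).
  have pi0 := pi_gt0 R.
  have E (p s : R) : 0 < p -> p * s = (2 * p) ^+ 2 * (s / 4 / p).
    by move=> p0; field; rewrite gt_eqF.
  rewrite /q invrK E// sqrtrM ?sqr_ge0// sqrtr_sqr ger0_norm//.
  by rewrite mulr_ge0// ltW.
have r m : (4 * q m)^-1 = m.+1%:R / 4.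
  by rewrite invfM invrK mulrC.
have test m : cintegral (fun y => f y * fourier (mgauss x (q m)) y) =
    cintegral (fun xi => g xi * mgauss x (q m) xi).
  exact: (fg _ (schwartz_mgauss x (q0 m))).
have igx : cintegrable (fun xi => expi (dotp x xi) * g xi).
  apply: (cintegrable_le _ (cintegrable_normc ig)).
    apply: cmeasurableM; last exact: cintegrable_cmeasurable.
    by apply: cmeasurable_expi; exact: measurable_dotp.
  by move=> xi; rewrite normcM normc_expi mul1r.
have [igr igi] := igx.
(* [P] stands for the real or the imaginary part: both are homogeneous for real factors and commute
   with [cintegral], so one argument serves for the two. *)
have lhs m (P : R[i] -> R) : (forall (c : R) z, P (z * c%:C) = P z * c) ->
    (forall h : F, P (cintegral h) = \int[mu]_y P (h y)) ->
    continuous (P \o f) -> (forall y, `|(P \o f) y| <= M) ->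
    P (cintegral (fun y => f y * fourier (mgauss x (q m)) y)) =
    (2 * pi) ^+ n * gauss_mean (P \o f) (m.+1%:R / 4) x.
  move=> PZ Pint cPf PfM; rewrite Pint /gauss_mean mulrA -K -RintegralZl//.
    apply: eq_Rintegral => y _.
    by rewrite fourier_mgauss// PZ r mulrCA.
  apply: (@integrable_mul_gaussV _ _ (P \o f) M cPf PfM).
  by rewrite divr_gt0.
have rhs m (P : R[i] -> R) : (forall (c : R) z, P (z * c%:C) = P z * c) ->
    (forall h : F, P (cintegral h) = \int[mu]_y P (h y)) ->
    P (cintegral (fun xi => g xi * mgauss x (q m) xi)) =
    \int[mu]_xi (P (expi (dotp x xi) * g xi) * gaussV (q m) xi).
  move=> PZ Pint; rewrite Pint; apply: eq_Rintegral => xi _.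
  by rewrite /mgauss mulrA PZ [g xi * _]mulrC.
have part (P : R[i] -> R) : (forall (c : R) z, P (z * c%:C) = P z * c) ->
    (forall h : F, P (cintegral h) = \int[mu]_y P (h y)) ->
    continuous (P \o f) -> (forall y, `|(P \o f) y| <= M) ->
    mu.-integrable setT (EFin \o (fun xi => P (expi (dotp x xi) * g xi))) ->
    P (((2 * pi) ^+ n)%:C * f x) = P (cintegral (fun xi => expi (dotp x xi) * g xi)).
  move=> PZ Pint cPf PfM iP; rewrite mulrC PZ mulrC Pint.
  have lim1 : (2 * pi) ^+ n * gauss_mean (P \o f) (m.+1%:R / 4) x @[m --> \oo] -->
      (2 * pi) ^+ n * (P \o f) x.
    by apply: cvgMl_tmp; exact: cvg_gauss_mean PfM _.
  have lim2 := cvg_Rintegral_gaussV iP.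
  rewrite -(funext (fun m => rhs m P PZ Pint)) in lim2.
  have E : (fun m => P (cintegral (fun xi => g xi * mgauss x (q m) xi))) =
      (fun m => (2 * pi) ^+ n * gauss_mean (P \o f) (m.+1%:R / 4) x).
    by apply/funext => m; rewrite -test lhs.
  rewrite E in lim2.
  exact: (cvg_unique _ lim1 lim2).
apply: complexP; apply: part => //.
- by move=> c z; rewrite cReM/= mulr0 subr0.
- by move=> c z; rewrite cImM/= mulr0 add0r.
Qed.

End inversion.

(** * Regularity of inverse Fourier transforms *)

Section synthesis.
Variables (R : realType) (n : nat).
Local Notation Rn := 'rV[R]_n.
Local Notation F := (Rn -> R[i]).
Local Notation mu := (lebesgue_rV R n).
Variables (A : Rn -> R) (k : nat) (gamma : R).
Hypothesis A_ge0 : forall xi, 0 <= A xi.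
Hypothesis gamma01 : 0 < gamma <= 1.
Let W xi := japanese xi `^ (k%:R + gamma) * A xi.
Hypothesis iW : mu.-integrable setT (EFin \o W).
Implicit Types (h v : F) (x xi : Rn) (m : nat).

(** The inverse Fourier transform without its factor (2 pi)^(-n), which is absorbed in [h]. *)
Definition fsynth h : F := fun x => cintegral (fun xi => expi (dotp x xi) * h xi).

(* Up to a constant, [A] is the modulus of the Fourier transform of [f]; the
   partial derivatives of [f] of order [m] are of class [m]. *)
Definition synth_class m v := exists h, [/\ cmeasurable h,
  forall xi, cabs (h xi) <= japanese xi ^+ m * A xi & v = fsynth h].

Let japaneseX_powR_le m xi : (m <= k)%N ->
  japanese xi ^+ m * A xi * japanese xi `^ gamma <= W xi.
Proof.
move=> mk; rewrite mulrAC ler_wpM2r//.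
have j1 := japanese_ge1 xi; have j0 : 0 < japanese xi by exact: japanese_gt0.
rewrite -powR_mulrn; last exact: ltW.
rewrite -powRD; last by rewrite (gt_eqF j0) implybT.
by rewrite ler_powR// lerD2r ler_nat.
Qed.

Let japaneseX_le m xi : (m <= k)%N -> japanese xi ^+ m * A xi <= W xi.
Proof.
move=> mk; apply: le_trans (japaneseX_powR_le xi mk).
have j1 := japanese_ge1 xi.
have W0 : 0 <= japanese xi ^+ m * A xi.
  by rewrite mulr_ge0// exprn_ge0// (le_trans ler01).
apply: ler_peMr => //; rewrite -(powRr0 (japanese xi)) ler_powR//.
by case/andP : gamma01 => /ltW.
Qed.

Let cmeasurable_phase x h : cmeasurable h ->
  cmeasurable (fun xi => expi (dotp x xi) * h xi).
Proof. by apply: cmeasurableM; apply: cmeasurable_expi; exact: measurable_dotp. Qed.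

Lemma synth_class_le m v x : (m <= k)%N -> synth_class m v ->
  cabs (v x) <= 2 * \int[mu]_xi W xi.
Proof.
move=> mk [h [mh hA ->]]; apply: normc_cintegral_le => //.
  exact: cmeasurable_phase.
by move=> xi; rewrite normcM normc_expi mul1r (le_trans (hA _))// japaneseX_le.
Qed.

(** In the constant, one factor 2 comes from [normc_cintegral_le], the other from [normc_expiB_le],
    and n^gamma from [normr_dotp_le]. The increment of the phase supplies <xi>^gamma, and m + gamma
    <= k + gamma keeps the integrand below a multiple of [W]. *)
Lemma synth_class_holder m v x y : (m <= k)%N -> synth_class m v ->
  cabs (v x - v y) <=
    4 * n%:R `^ gamma * (\int[mu]_xi W xi) * enorm (x - y) `^ gamma.
Proof.
move=> mk [h [mh hA ->]].
have ih z : cintegrable (fun xi => expi (dotp z xi) * h xi).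
  apply: (cintegrable_le _ iW); first exact: cmeasurable_phase.
  by move=> xi; rewrite normcM normc_expi mul1r (le_trans (hA _))// japaneseX_le.
rewrite /fsynth -cintegralB//.
pose D := 2 * (n%:R `^ gamma * enorm (x - y) `^ gamma).
have D0 : 0 <= D by rewrite !mulr_ge0 ?powR_ge0.
have -> : 4 * n%:R `^ gamma * (\int[mu]_xi W xi) * enorm (x - y) `^ gamma =
    2 * \int[mu]_xi (D * W xi) by rewrite RintegralZl// /D; ring.
apply: normc_cintegral_le.
- have [mx my] := (cmeasurable_phase x mh, cmeasurable_phase y mh).
  split.
    rewrite (_ : _ \o _ = (@complex.Re R \o (fun xi => expi (dotp x xi) * h xi)) \-
      (@complex.Re R \o (fun xi => expi (dotp y xi) * h xi))).
      by apply: measurable_funB; [case: mx|case: my].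
    by apply/funext => xi; exact: cReB.
  rewrite (_ : _ \o _ = (@complex.Im R \o (fun xi => expi (dotp x xi) * h xi)) \-
      (@complex.Im R \o (fun xi => expi (dotp y xi) * h xi))).
    by apply: measurable_funB; [case: mx|case: my].
  by apply/funext => xi; exact: cImB.
- exact: integrableZr.
- move=> xi; rewrite -mulrBl normcM.
  have j0 : 0 <= japanese xi := ltW (japanese_gt0 xi).
  apply: (@le_trans _ _ (D * japanese xi `^ gamma * (japanese xi ^+ m * A xi))).
    apply: ler_pM; rewrite ?normc_ge0//.
    apply: (le_trans (normc_expiB_le _ _ gamma01)).
    rewrite -dotpBl /D -mulrA ler_pM2l// -!powRM ?mulr_ge0 ?enorm_ge0//.
    apply: ge0_ler_powR; rewrite ?nnegrE ?mulr_ge0 ?enorm_ge0//.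
      by case/andP : gamma01 => /ltW.
    apply: (le_trans (normr_dotp_le _ _)); rewrite mulrA ler_wpM2l ?mulr_ge0 ?enorm_ge0//.
    exact: enorm_le_japanese.
  rewrite -mulrA ler_wpM2l// [leLHS]mulrC.
  exact: japaneseX_powR_le.
Qed.

Lemma holder_continuous (u : Rn -> R) (C : R) :
  (forall x y, `|u x - u y| <= C * enorm (x - y) `^ gamma) -> continuous u.
Proof.
have /andP[g0 _] := gamma01; have g0' := ltW g0.
move=> uC x; apply/(@cvgrPdist_le _ _ _ (nbhs x)) => e e0.
(* The factor n^gamma converts the Euclidean norm into the max norm of the topology, and the added 1
   makes [C'] a positive divisor. *)
pose C' := `|C| * n%:R `^ gamma + 1.
have C'0 : 0 < C' by rewrite ltr_wpDl// mulr_ge0// powR_ge0.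
have d0 : 0 < (e / C') `^ gamma^-1 by rewrite powR_gt0// divr_gt0.
apply/nbhs_ballP; exists ((e / C') `^ gamma^-1) => //= y.
rewrite mx_norm_ball /ball_/= => xy.
apply: (le_trans (uC x y)); apply: (@le_trans _ _ (C' * `|x - y| `^ gamma)).
  apply: (@le_trans _ _ (`|C| * (n%:R `^ gamma * `|x - y| `^ gamma))).
    apply: (le_trans (ler_wpM2r (powR_ge0 _ _) (ler_norm C))).
    rewrite ler_wpM2l// -powRM//; apply: ge0_ler_powR => //.
    - by rewrite nnegrE enorm_ge0.
    - by rewrite nnegrE mulr_ge0.
    - exact: enorm_le_normr.
  by rewrite mulrA ler_wpM2r ?powR_ge0// lerDl.
rewrite mulrC -ler_pdivlMr//.
have -> : e / C' = ((e / C') `^ gamma^-1) `^ gamma.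
  by rewrite -powRrM mulVf ?gt_eqF// powRr1// divr_ge0 ?ltW.
by apply: ge0_ler_powR => //; rewrite ?nnegrE ?powR_ge0//; exact: ltW.
Qed.

(** Continuity is read off from the Hoelder bound, which is available at every order m <= k. *)
Lemma synth_class_continuous m v : (m <= k)%N -> synth_class m v -> ccontinuous v.
Proof.
move=> mk Vv; pose C := 4 * n%:R `^ gamma * (\int[mu]_xi W xi).
split; apply: (@holder_continuous _ C) => x y.
- rewrite /= -cReB; apply: le_trans (normr_Re_le _) _.
  exact: synth_class_holder Vv.
- rewrite /= -cImB; apply: le_trans (normr_Im_le _) _.
  exact: synth_class_holder Vv.
Qed.

(** Writing - sin s as cos (pi / 2 + s) leaves only cosines with a constant phase, the form that
    [is_derive_integral_cos] differentiates. *)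
Lemma Re_fsynth h x : cintegrable h -> complex.Re (fsynth h x) =
  \int[mu]_xi (cos (0 + dotp x xi) * complex.Re (h xi)) +
  \int[mu]_xi (cos (pi / 2 + dotp x xi) * complex.Im (h xi)).
Proof.
move=> [hr hi]; have mph c : measurable_fun setT (fun xi : Rn => c + dotp x xi).
  by apply: measurable_funD => //; exact: measurable_dotp.
rewrite -RintegralD//; try exact: integrable_cosM.
apply: eq_Rintegral => xi _.
by rewrite cReM/= add0r [pi / 2 + _]addrC cosDpihalf mulNr.
Qed.

Lemma Im_fsynth h x : cintegrable h -> complex.Im (fsynth h x) =
  \int[mu]_xi (cos (- (pi / 2) + dotp x xi) * complex.Re (h xi)) +
  \int[mu]_xi (cos (0 + dotp x xi) * complex.Im (h xi)).
Proof.
move=> [hr hi]; have mph c : measurable_fun setT (fun xi : Rn => c + dotp x xi).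
  by apply: measurable_funD => //; exact: measurable_dotp.
rewrite -RintegralD//; try exact: integrable_cosM.
apply: eq_Rintegral => xi _.
by rewrite cImM/= add0r [- _ + _]addrC cosBpihalf [RHS]addrC.
Qed.

(** Differentiation replaces h(xi) by i xi_i h(xi). As m < k, the new density is still dominated by
    the integrable [W], which justifies differentiating under the integral. *)
Lemma synth_class_partial m v i : (m < k)%N -> synth_class m v ->
  exists2 v', synth_class m.+1 v' & forall x, is_cderive x (basis_vec i) v (v' x).
Proof.
move=> mk [h [mh hA ->]].
pose hr xi := complex.Re (h xi); pose hi xi := complex.Im (h xi).
have [mr mi] := mh.
pose h' xi := (0 +i* xi 0 i) * h xi.
have h'E xi : h' xi = (- (xi 0 i * hi xi)) +i* (xi 0 i * hr xi).
  by apply: complexP; rewrite /h' ?cReM ?cImM/= mul0r ?sub0r ?add0r.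
have h'A xi : cabs (h' xi) <= japanese xi ^+ m.+1 * A xi.
  rewrite normcM exprS -mulrA ler_pM ?normc_ge0//.
  by rewrite normcE/= expr0n add0r sqrtr_sqr coord_le_japanese.
have mh' : cmeasurable h'.
  apply: cmeasurableM => //; split; first exact: measurable_cst.
  exact: measurable_coord.
have ih : cintegrable h.
  by apply: (cintegrable_le mh iW) => xi; rewrite (le_trans (hA _))// japaneseX_le// ltnW.
have ih' : cintegrable h'.
  by apply: (cintegrable_le mh' iW) => xi; rewrite (le_trans (h'A _))// japaneseX_le.
exists (fsynth h'); first by exists h'.
have [ihr ihi] := ih; have [ih'r ih'i] := ih'.
have ixr : mu.-integrable setT (EFin \o (fun xi => xi 0 i * hr xi)).
  by move: ih'i; rewrite (_ : _ \o _ = EFin \o (fun xi => xi 0 i * hr xi))//;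
    apply/funext => xi /=; rewrite h'E.
have ixi : mu.-integrable setT (EFin \o (fun xi => xi 0 i * hi xi)).
  have := integrableZr (-1) ih'r.
  rewrite (_ : _ \o _ = EFin \o (fun xi => xi 0 i * hi xi))//;
    by apply/funext => xi /=; rewrite h'E/= mulN1r opprK.
have mph c x : measurable_fun setT (fun xi : Rn => c + dotp x xi).
  by apply: measurable_funD => //; exact: measurable_dotp.
have d c x (u : Rn -> R) : mu.-integrable setT (EFin \o u) ->
    mu.-integrable setT (EFin \o (fun xi => xi 0 i * u xi)) ->
  is_derive (0 : R) 1 (fun t => \int[mu]_xi (cos (c + dotp x xi + t * xi 0 i) * u xi))
    (\int[mu]_xi (- sin (c + dotp x xi) * (xi 0 i * u xi))).
  move=> iu ixu; have := @is_derive_integral_cos _ _ _ mu (fun xi : Rn => xi 0 i)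
    (fun xi => c + dotp x xi) u 0 (measurable_coord i) (mph c x) iu ixu.
  by under [in X in is_derive _ _ _ X]eq_Rintegral do rewrite mul0r addr0.
have E t x xi : dotp (t *: basis_vec i + x) xi = dotp x xi + t * xi 0 i.
  by rewrite dotpDl dotpZl dotp_basis_vec addrC.
have EI c x t (u : Rn -> R) :
    \int[mu]_xi (cos (c + dotp (t *: basis_vec i + x) xi) * u xi) =
    \int[mu]_xi (cos (c + dotp x xi + t * xi 0 i) * u xi).
  by apply: eq_Rintegral => xi _; rewrite E addrA.
have NI (u w : Rn -> R) : (forall xi, u xi = w xi) -> \int[mu]_xi u xi = \int[mu]_xi w xi.
  by move=> uw; apply: eq_Rintegral => xi _.
move=> x; split.
- suff H : is_derive (0 : R) 1
      (fun t => complex.Re (fsynth h (t *: basis_vec i + x)))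
      (complex.Re (fsynth h' x)) by exact: (is_derive_line H).
  under eq_fun do rewrite Re_fsynth// !EI.
  (* Multiplication by i exchanges the two parts, so the derivative of the term in Re h is the term
     in Im h'; the summands are swapped to match. *)
  rewrite Re_fsynth// addrC.
  rewrite (NI (fun xi => cos (pi / 2 + dotp x xi) * complex.Im (h' xi))
    (fun xi => - sin (0 + dotp x xi) * (xi 0 i * hr xi))); last first.
    by move=> xi; rewrite h'E/= add0r [pi / 2 + _]addrC cosDpihalf.
  rewrite (NI (fun xi => cos (0 + dotp x xi) * complex.Re (h' xi))
    (fun xi => - sin (pi / 2 + dotp x xi) * (xi 0 i * hi xi))); last first.
    by move=> xi; rewrite h'E/= add0r [pi / 2 + _]addrC sinDpihalf mulrN mulNr.
  by apply: is_deriveD; exact: d.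
- suff H : is_derive (0 : R) 1
      (fun t => complex.Im (fsynth h (t *: basis_vec i + x)))
      (complex.Im (fsynth h' x)) by exact: (is_derive_line H).
  under eq_fun do rewrite Im_fsynth// !EI.
  rewrite Im_fsynth// addrC.
  rewrite (NI (fun xi => cos (0 + dotp x xi) * complex.Im (h' xi))
    (fun xi => - sin (- (pi / 2) + dotp x xi) * (xi 0 i * hr xi))); last first.
    by move=> xi; rewrite h'E/= add0r [- _ + _]addrC sinBpihalf opprK.
  rewrite (NI (fun xi => cos (- (pi / 2) + dotp x xi) * complex.Re (h' xi))
    (fun xi => - sin (0 + dotp x xi) * (xi 0 i * hi xi))); last first.
    by move=> xi; rewrite h'E/= add0r [- _ + _]addrC cosBpihalf mulrN mulNr.
  by apply: is_deriveD; exact: d.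
Qed.

(** Here [m] counts the derivatives already taken and [p] those still available; the induction moves
    one unit from [p] to [m]. *)
Lemma synth_class_Ck p m v : (m + p)%N = k -> synth_class m v -> Ck p v.
Proof.
elim: p m v => [|p IH] m v mpk Vv.
  by split => //; apply: (synth_class_continuous _ Vv); rewrite -mpk leq_addr.
split; first by apply: (synth_class_continuous _ Vv); rewrite -mpk leq_addr.
have mk : (m < k)%N by rewrite -mpk addnS ltnS leq_addr.
move=> i; have [v' Vv' dv] := synth_class_partial i mk Vv.
have [? ->] := is_cderive_partial dv; split => //.
by apply: IH Vv'; rewrite -mpk addSnnS.
Qed.

Lemma synth_class_mpartial al v : (mi_order al <= k)%N -> synth_class 0 v ->
  synth_class (mi_order al) (mpartial al v).
Proof.
move=> alk Vv; rewrite /mpartial.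
have E : mi_order al = (\sum_(i <- enum 'I_n) al i)%N by rewrite /mi_order big_enum.
(* Replacing the enumeration by an arbitrary list lets the order and the iterated derivative recurse
   together. *)
rewrite E; rewrite {}E in alk; move: alk; elim: (enum _) => [|i s IH].
  by rewrite big_nil.
rewrite big_cons /=; elim: (al i) => [|p IHp] pk; first exact: IH.
have [v' Vv' dv] := synth_class_partial i pk (IHp (ltnW pk)).
by rewrite addSn iterS; have [_ ->] := is_cderive_partial dv.
Qed.

End synthesis.

(** * From bounds on derivatives to the embedding *)

Section embedding.
Variables (R : realType) (n : nat).
Local Notation Rn := 'rV[R]_n.
Local Notation F := (Rn -> R[i]).
Local Notation mu := (lebesgue_rV R n).
Implicit Types f : F.

Lemma Cb0_bounded f : Cb 0 f -> exists M : R, forall x, cabs (f x) <= M.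
Proof.
move=> [_ bf]; pose a0 : @multi_index n := [ffun=> 0%N].
have a00 : (mi_order a0 <= 0)%N.
  by rewrite /mi_order big1// => i _; rewrite ffunE.
have := bf _ a00; have -> : mpartial a0 f = f.
  by rewrite /mpartial; elim: (enum _) => //= i s ->; rewrite ffunE.
rewrite /sup_norm; set S := [set _ | _ in _] => supoo.
exists (fine (ereal_sup S)) => x.
have Sx : S (cabs (f x))%:E by exists x.
have le_sup := ereal_sup_ubound Sx.
(* The supremum is not -oo either, since it dominates a real value. *)
rewrite -lee_fin fineK// fin_numE -ltey supoo andbT.
by apply/negP => /eqP E; move: le_sup; rewrite E.
Qed.

Lemma le_holder_seminorm (b C : R) f :
  (forall x y, cabs (f x - f y) <= C * enorm (x - y) `^ b) ->
  (holder_seminorm b f <= C%:E)%E.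
Proof.
move=> fC; apply: ge_ereal_sup => _ [[x y] /= xy <-]; rewrite lee_fin.
rewrite ler_pdivrMr// powR_gt0// lt_neqAle enorm_ge0 andbT eq_sym enorm_eq0.
by rewrite subr_eq0.
Qed.

Lemma le_sup_norm (C : R) f : (forall x, cabs (f x) <= C) ->
  (sup_norm f <= C%:E)%E.
Proof. by move=> fC; apply: ge_ereal_sup => _ [x _ <-]; rewrite lee_fin. Qed.

Lemma fourierL1P f : (exists g, is_fourierL1 f g) -> is_fourierL1 f (fourierL1 f).
Proof. by move=> [g fg]; exact: (xgetI _ fg). Qed.

Lemma weighted_fourier_normc s f x :
  cabs (weighted_fourier s f x) = japanese x `^ s * cabs (fourierL1 f x).
Proof. by rewrite normcM normcC ger0_norm ?powR_ge0. Qed.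

Lemma B_normE s f : cintegrable (weighted_fourier s f) ->
  B_norm n s f = (\int[mu]_xi cabs (weighted_fourier s f xi))%:E.
Proof.
move=> /cintegrable_normc iw.
by rewrite /Rintegral fineK//; exact: integrable_fin_num.
Qed.

End embedding.

Unset Implicit Arguments.
Theorem theorem2p4 (R : realType) (n : nat) (n_gt0 : (0 < n)%N)
    (k : nat) (theta : R) (theta01 : 0 < theta < 1)
    (gamma : R) (gamma_theta : 0 < gamma < theta) :
  continuous_embedding
    (Bspace n (k%:R + theta)) (B_norm n (k%:R + theta))
    (Cb_holder n k gamma) (Cb_holder_norm n k gamma).
Proof.
have /andP[theta0 theta1] := theta01; have /andP[gamma0 gammat] := gamma_theta.
have gamma01 : 0 < gamma <= 1 by rewrite gamma0 ltW// (lt_trans gammat).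
set s := k%:R + theta; pose mu := lebesgue_rV R n.
pose c : R := ((2 * pi) ^+ n)^-1.
have c0 : 0 < c by rewrite invr_gt0 exprn_gt0// mulr_gt0// pi_gt0.
(* The constants of [synth_class_le] and [synth_class_holder], each times the factor [c] of the
   inversion formula. *)
pose C1 : R := 2 * c; pose C2 : R := 4 * n%:R `^ gamma * c.
(* The norm of [f] is finite, so both the membership and the norm estimate can be derived from
   inequalities with one real number [N]. *)
have main f : Bspace n s f -> exists N : R, [/\ B_norm n s f = N%:E,
    Ck k f, forall a, (mi_order a <= k)%N ->
      (sup_norm (mpartial a f) <= (C1 * N)%:E)%E &
    forall a, mi_order a = k ->
      (holder_seminorm gamma (mpartial a f) <= (C2 * N)%:E)%E].
  move=> [Cb0f [exg iw]]; have fg := fourierL1P exg; set g := fourierL1 f in fg.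
  have [M fM] := Cb0_bounded Cb0f.
  exists (\int[mu]_xi cabs (weighted_fourier s f xi)); set N := Rintegral _ _ _.
  pose A xi := c * cabs (g xi).
  have A0 xi : 0 <= A xi by rewrite mulr_ge0 ?normc_ge0// ltW.
  pose W xi := japanese xi `^ (k%:R + gamma) * A xi.
  have [ig _] := fg; have mg := cintegrable_cmeasurable ig.
  (* The comparison of gamma with theta enters here: as <xi> >= 1, the weight of exponent k + gamma
     is at most the one of exponent k + theta. *)
  have WN xi : `|W xi| <= c * cabs (weighted_fourier s f xi).
    rewrite ger0_norm; last by rewrite mulr_ge0// powR_ge0.
    rewrite weighted_fourier_normc /W /A mulrCA.
    rewrite ler_pM2l// ler_wpM2r ?normc_ge0// ler_powR ?japanese_ge1//.
    by rewrite lerD2l ltW.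
  have iN := integrableZr c (cintegrable_normc iw).
  have iW : mu.-integrable setT (EFin \o W).
    apply: (integrable_le _ iN) => //.
    rewrite /W /A; apply: measurable_funM.
      by apply: (measurableT_comp (measurable_powR _)); exact: measurable_japanese.
    by apply: measurable_funM => //; exact: cmeasurable_normc.
  have intW : \int[mu]_xi W xi <= c * N.
    rewrite -RintegralZl//; last exact: cintegrable_normc.
    apply: le_Rintegral => // xi _; exact: le_trans (ler_norm _) (WN xi).
  have Vf : synth_class A 0 f.
    exists (fun xi => c%:C * g xi); split.
    - by apply: cmeasurableM => //; exact: cmeasurableC.
    - by move=> xi; rewrite expr0 mul1r normcM normcC gtr0_norm.
    - apply/funext => x; have := fourier_inversion x Cb0f.1.1 fM fg => E.
      rewrite /fsynth.
      (* Inversion determines (2 pi)^n f(x); the factor [c] is inserted to cancel the power and then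
         moved under the integral. *)
      transitivity (c%:C * (((2 * pi) ^+ n)%:C * f x)).
        rewrite mulrA -[(_)%:C * _]rmorphM/= mulVf ?mul1r//.
        by rewrite -invr_eq0 gt_eqF.
      rewrite E -cintegralZ.
        by congr cintegral; apply/funext => xi; rewrite mulrCA.
      apply: (cintegrable_le _ (cintegrable_normc ig)).
        by apply: cmeasurableM => //; apply: cmeasurable_expi; exact: measurable_dotp.
      by move=> xi; rewrite normcM normc_expi mul1r.
  split.
  - exact: B_normE.
  - exact: (synth_class_Ck A0 gamma01 iW (add0n k) Vf).
  - move=> a ak; apply: le_sup_norm => x.
    apply: (le_trans (synth_class_le A0 gamma01 iW x ak
      (synth_class_mpartial A0 gamma01 iW ak Vf))).
    by rewrite /C1 -mulrA ler_pM2l.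
  - move=> a ak; have ak' : (mi_order a <= k)%N by rewrite ak.
    apply: le_holder_seminorm => x y.
    apply: (le_trans (synth_class_holder A0 gamma01 iW x y ak'
      (synth_class_mpartial A0 gamma01 iW ak' Vf))).
    by rewrite ler_wpM2r ?powR_ge0// /C2 -[leRHS]mulrA ler_wpM2l//.
split=> [f Bf|].
  have [N [_ Ckf supf holf]] := main f Bf; split.
    by split => // a ak; exact: le_lt_trans (supf a ak) (ltry _).
  by move=> a ak; exact: le_lt_trans (holf a ak) (ltry _).
exists (C1 + C2); split; first by rewrite ltr_pwDl ?mulr_ge0 ?powR_ge0 ?mulr_gt0// ltW.
move=> f Bf; have [N [-> Ckf supf holf]] := main f Bf.
rewrite -EFinM mulrDl EFinD /Cb_holder_norm; apply: leeD.
  by apply: ge_ereal_sup => _ [a ak <-]; exact: supf.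
by apply: ge_ereal_sup => _ [a ak <-]; exact: holf.
Qed.
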